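(* Let $X$ be a Banach space, $K\subset X^*$ weak$^*$-compact, $\xi$ an ordinal, and $1<p\leqslant\infty$. Then $$\alpha_{\xi,p}(K)=\alpha_{\xi,p}\bigl(\overline{\text{abs co}}^{\text{weak}^*}(K)\bigr),$$ where $\overline{\text{abs co}}^{\text{weak}^*}(K)$ denotes the weak$^*$-closed absolutely convex hull of $K$.
   Context: Conventions. $\mathbb{N}=\{1,2,\ldots\}$; $\mathbb{K}$ is the scalar field ($\mathbb{R}$ or $\mathbb{C}$); $B_X$ is the closed unit ball of $X$. Trees. Sequences are finite and non-empty; $s\leqslant t$ (resp. $s<t$) means $s$ is an initial segment (resp. proper initial segment) of $t$; $MAX(T)$ is the set of $\leqslant$-maximal members of $T$; $\frown$ is concatenation; for an ordinal $\zeta$ and a sequence of ordinals $t=(\zeta_j)_{j=1}^k$, $\zeta+t=(\zeta+\zeta_j)_{j=1}^k$, and $\zeta+G=\{\zeta+t:t\in G\}$. Define sets $\Gamma_{\xi,n}$ and functions $\mathbb{P}_{\xi,n}:\Gamma_{\xi,n}\to(0,1]$ recursively. $\Gamma_{0,1}=\{(0)\}$, $\mathbb{P}_{0,1}((0))=1$. Given $\Gamma_{\xi,1},\mathbb{P}_{\xi,1}$, for $n\in\mathbb{N}$ and $1\leqslant i\leqslant n$ let $\Lambda_{\xi,n,i}$ be the set of all $(\omega^\xi(n-1)+t_1)\frown\ldots\frown(\omega^\xi(n-i)+t_i)$ with $t_1,\ldots,t_{i-1}\in MAX(\Gamma_{\xi,1})$, $t_i\in\Gamma_{\xi,1}$;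 let $\Gamma_{\xi,n}=\bigcup_{i=1}^n\Lambda_{\xi,n,i}$, and let $\mathbb{P}_{\xi,n}$ take the value $\mathbb{P}_{\xi,1}(t_i)$ at the displayed sequence. $\Gamma_{\xi+1,1}=\bigcup_{n=1}^\infty\Gamma_{\xi,n}$ (a disjoint union) and $\mathbb{P}_{\xi+1,1}|_{\Gamma_{\xi,n}}=n^{-1}\mathbb{P}_{\xi,n}$. If $\xi$ is a limit ordinal, $\Gamma_{\xi,1}=\bigcup_{\zeta<\xi}(\omega^\zeta+\Gamma_{\zeta+1,1})$ (a disjoint union) and $\mathbb{P}_{\xi,1}(\omega^\zeta+t)=\mathbb{P}_{\zeta+1,1}(t)$. For a directed set $D$, $\Gamma_{\xi,n}.D$ (resp. $\Lambda_{\xi,n,i}.D$) is the set of sequences $(\zeta_j,u_j)_{j=1}^k$ with $(\zeta_j)_{j=1}^k\in\Gamma_{\xi,n}$ (resp. $\Lambda_{\xi,n,i}$) and $u_j\in D$; put $\mathbb{P}_{\xi,n}((\zeta_j,u_j)_{j=1}^k)=\mathbb{P}_{\xi,n}((\zeta_j)_{j=1}^k)$. A collection $(x_t)_{t\in\Gamma_{\xi,n}.D}$ in a Banach space is weakly null if whenever $s\in\{\varnothing\}\cup\Gamma_{\xi,n}.D$ and an ordinal $\zeta$ are such that $s\frown(\zeta,u)\in\Gamma_{\xi,n}.D$ for $u\in D$, the net $(x_{s\frown(\zeta,u)})_{u\in D}$ is weakly null. For $t\in MAX(\Gamma_{\xi,n}.D)$ and $1\leqslant i\leqslant n$, $z_i^t=\sum_{t\geqslant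 s\in\Lambda_{\xi,n,i}.D}\mathbb{P}_{\xi,n}(s)x_s$. The quantities $\alpha$. For $x\in X$ let $r_K(x)=\max_{x^*\in K}\mathrm{Re}\,x^*(x)$ if $K\neq\varnothing$ and $r_\varnothing(x)=0$. For $1\leqslant p\leqslant\infty$, $\alpha_{\xi,p,n}(K)$ is the infimum of those $\alpha>0$ such that for any directed set $D$, any $(a_i)_{i=1}^n\in\mathbb{K}^n$ and any weakly null $(x_t)_{t\in\Gamma_{\xi,n}.D}\subset B_X$, $\inf_{t\in MAX(\Gamma_{\xi,n}.D)}r_K(\sum_{i=1}^na_iz_i^t)\leqslant\alpha\|(a_i)_{i=1}^n\|_{\ell_p^n}$; and $\alpha_{\xi,p}(K)=\sup_n\alpha_{\xi,p,n}(K)\in[0,\infty]$. *)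

(* Defs.v *)
From HB Require Import structures.
From mathcomp Require Import all_boot all_order all_algebra.
From mathcomp Require Import complex.
From mathcomp Require Import all_classical all_reals all_analysis.

Set Implicit Arguments.
Unset Strict Implicit.
Unset Printing Implicit Defensive.

Import Order.TTheory GRing.Theory Num.Theory.
Import numFieldNormedType.Exports.

Local Open Scope classical_set_scope.
Local Open Scope ring_scope.

(** [OSup f] denotes the least ordinal strictly above all the [f i].  Ordinals
    are these trees up to mutual [tle]. *)
Inductive otree : Type := OSup (A : Type) (f : A -> otree).

Fixpoint tle (x y : otree) : Prop :=
  match x, y with OSup A f, OSup B g => forall i, exists j, tle (f i) (g j) end.

Definition tlt (x y : otree) : Prop :=
  match y with OSup B g => exists j, tle x (g j) end.

Definition teq (x y : otree) : Prop := tle x y /\ tle y x.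

Lemma tle_refl x : tle x x.
Proof. by elim: x => A f IH /= i; exists i. Qed.

Lemma tle_trans y x z : tle x y -> tle y z -> tle x z.
Proof.
elim: x y z => A f IH [B g] [C h] /= fg gh i.
by have [j fgj] := fg i; have [l ghl] := gh j; exists l; apply: IH fgj ghl.
Qed.

Lemma tle_child A (f : A -> otree) i : tle (f i) (OSup f).
Proof.
have H : forall x, match x with OSup A f => forall i, tle (f i) (OSup f) end.
  elim=> {A f i} A f IH i; move: (IH i); case E : (f i) => [B g] /= H j.
  by exists i; rewrite E; apply: H.
exact: (H (OSup f)).
Qed.

Lemma tltW x y : tlt x y -> tle x y.
Proof. by case: y => B g [j /tle_trans]; apply; apply: tle_child. Qed.

Lemma tle_lt_trans y x z : tle x y -> tlt y z -> tlt x z.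
Proof. by case: z => B g xy [j yg]; exists j; apply: tle_trans yg. Qed.

Lemma tlt_le_trans y x z : tlt x y -> tle y z -> tlt x z.
Proof.
by case: y z => B g [C h] [j xg] /(_ j)[l gh]; exists l; apply: tle_trans gh.
Qed.

Lemma tleNgt x y : ~ tle x y -> tlt y x.
Proof.
elim: x y => A f IH [B g] /= H.
have [i0 /forallNP fg] := (iffRL (existsNP _)) H; exists i0.
by case E : (f i0) (IH i0) fg => [C h] /= IHi fgi j; exact: IHi.
Qed.

Lemma tlt_irr x : ~ tlt x x.
Proof.
elim: x => A f IH [i0] /=; case E : (f i0) (IH i0) => [B g] IHi.
by move=> /(_ i0); rewrite E => -[j] H; apply: IHi; exists j.
Qed.

Lemma tlt_wf : well_founded tlt.
Proof.
suff H x y : tle y x -> Acc tlt y by move=> x; apply: (H x); apply: tle_refl.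
elim: x y => A f IH [B g] /= gf; constructor => z [j zg].
by have [i gfi] := gf j; apply: (IH i); apply: tle_trans gfi.
Qed.

(** [x + y] is the least ordinal above all [x' < x] and all [x + y'], [y' < y]. *)
Fixpoint tadd (x y : otree) : otree :=
  match x, y with
  | OSup A f, OSup B g =>
      OSup (fun k : A + B => match k with inl i => f i | inr j => tadd x (g j) end)
  end.

Definition tzero : otree := OSup (of_void otree).

Definition tsucc (x : otree) : otree := OSup (fun _ : unit => x).

Fixpoint tmul (x : otree) (n : nat) : otree :=
  if n is m.+1 then tadd (tmul x m) x else tzero.

(** [omega ^ y] is the least ordinal above [0] and all [omega ^ y' * n] with
    [y' < y] and [n] finite. *)
Fixpoint texp (y : otree) : otree :=
  match y with
  | OSup B g => OSup (fun k : option (B * nat) =>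
      match k with Some (j, n) => tmul (texp (g j)) n | None => tzero end)
  end.

Definition ord : Type := {Z : set otree | exists x, Z = teq x}.

Definition opi (x : otree) : ord := exist _ (teq x) (ex_intro _ x erefl).
Definition orepr (a : ord) : otree := sval (cid (svalP a)).

Definition ole (a b : ord) : Prop := tle (orepr a) (orepr b).
Definition olt (a b : ord) : Prop := tlt (orepr a) (orepr b).
Definition ozero : ord := opi tzero.
Definition osucc (a : ord) : ord := opi (tsucc (orepr a)).
Definition oadd (a b : ord) : ord := opi (tadd (orepr a) (orepr b)).
Definition omul (a : ord) (n : nat) : ord := opi (tmul (orepr a) n).
Definition oexp (a : ord) : ord := opi (texp (orepr a)).
Definition olimit (a : ord) : Prop := a <> ozero /\ forall b, a <> osucc b.

Lemma olt_wf : well_founded olt.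
Proof.
suff H x : Acc tlt x -> forall a, orepr a = x -> Acc olt a.
  by move=> a; apply: (H _ (tlt_wf (orepr a))).
elim=> {}x _ IH a xa; constructor => b ba.
by apply: (IH (orepr b)) => //; rewrite -xa.
Qed.

Lemma oreprK a : opi (orepr a) = a.
Proof.
case: a => Z hC; apply: eq_exist; rewrite /orepr.
by case: cid => x /= ->.
Qed.

Lemma teq_sym x y : teq x y -> teq y x. Proof. by case. Qed.

Lemma teq_trans y x z : teq x y -> teq y z -> teq x z.
Proof. by move=> [? ?] [? ?]; split; apply: (@tle_trans y). Qed.

Lemma opiP x y : opi x = opi y <-> teq x y.
Proof.
split=> [[e]|xy].
  by rewrite e; split; apply: tle_refl.
apply: eq_exist; apply/funext => z; apply/propext; split; apply: teq_trans => //.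
exact: teq_sym.
Qed.

Lemma opiK x : teq (orepr (opi x)) x.
Proof. by apply/opiP; rewrite oreprK. Qed.

Lemma ole_anti a b : ole a b -> ole b a -> a = b.
Proof. by move=> ab ba; rewrite -(oreprK a) -(oreprK b); apply/opiP. Qed.

Lemma ole_total a b : ole a b \/ olt b a.
Proof. by have [|/tleNgt] := pselect (ole a b); [left|right]. Qed.

Lemma olt_irr a : ~ olt a a. Proof. exact: tlt_irr. Qed.

Lemma ole_refl a : ole a a. Proof. exact: tle_refl. Qed.

Lemma ole_trans b a c : ole a b -> ole b c -> ole a c.
Proof. exact: tle_trans. Qed.

Lemma ole_lt_trans b a c : ole a b -> olt b c -> olt a c.
Proof. exact: tle_lt_trans. Qed.

Lemma olt_le_trans b a c : olt a b -> ole b c -> olt a c.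
Proof. exact: tlt_le_trans. Qed.

Lemma olt_opi a y : olt a (opi y) <-> tlt (orepr a) y.
Proof. by split=> /tlt_le_trans; apply; case: (opiK y). Qed.

Lemma olt_OSup B (g : B -> otree) a : olt a (opi (OSup g)) <-> exists j, ole a (opi (g j)).
Proof.
rewrite olt_opi; split=> -[j h]; exists j; rewrite /ole.
  by apply: tle_trans h _; case: (opiK (g j)).
by apply: tle_trans h _; case: (opiK (g j)).
Qed.


Lemma ole_opi x y : ole (opi x) (opi y) <-> tle x y.
Proof.
rewrite /ole; have [xa xb] := opiK x; have [ya yb] := opiK y.
split=> h; first exact: tle_trans xb (tle_trans h ya).
exact: tle_trans xa (tle_trans h yb).
Qed.

Lemma tadd_le x x' y y' : tle x x' -> tle y y' -> tle (tadd x y) (tadd x' y').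
Proof.
move=> xx'; elim: y y' => B g IH [B' g'] gg'.
case: x x' xx' IH => A f [A' f'] ff' IH [i|j].
  by have [i' fi'] := ff' i; exists (inl i').
by have [j' gj'] := gg' j; exists (inr j'); apply: IH.
Qed.

Lemma tmul_le x y n : tle x y -> tle (tmul x n) (tmul y n).
Proof. by move=> xy; elim: n => [|n IH] /=; [case | apply: tadd_le]. Qed.

Lemma texp_le x y : tle x y -> tle (texp x) (texp y).
Proof.
elim: x y => A f IH [B g] fg [[i n]|]; last by exists None; case.
have [j fj] := fg i; exists (Some (j, n)); apply: tmul_le; exact: IH.
Qed.

Lemma oadd_opi x y : oadd (opi x) (opi y) = opi (tadd x y).
Proof.
apply/opiP; have [? ?] := opiK x; have [? ?] := opiK y.
by split; apply: tadd_le.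
Qed.

Lemma omul_opi x n : omul (opi x) n = opi (tmul x n).
Proof. by apply/opiP; have [? ?] := opiK x; split; apply: tmul_le. Qed.

Lemma oexp_opi x : oexp (opi x) = opi (texp x).
Proof. by apply/opiP; have [? ?] := opiK x; split; apply: texp_le. Qed.

Lemma ord_ind_pi (P : ord -> Prop) : (forall x, P (opi x)) -> forall a, P a.
Proof. by move=> h a; rewrite -(oreprK a). Qed.

Lemma oltW a b : olt a b -> ole a b. Proof. exact: tltW. Qed.

Lemma olt0 a : ~ olt a ozero. Proof. by rewrite /ozero olt_OSup => -[[]]. Qed.

Lemma ole0 a : ole ozero a.
Proof. by elim/ord_ind_pi: a => x; apply/ole_opi; case: x => A f []. Qed.

Lemma olt_succ a b : olt a (osucc b) <-> ole a b.
Proof.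
rewrite /osucc olt_OSup oreprK; split=> [[_ //]|]; by exists tt.
Qed.

Lemma olt_add a b c :
  olt c (oadd a b) <-> olt c a \/ exists2 b', olt b' b & ole c (oadd a b').
Proof.
elim/ord_ind_pi: a => -[A f]; elim/ord_ind_pi: b => -[B g].
rewrite oadd_opi /tadd -/tadd !olt_OSup; split.
  move=> [[i|j] h]; [left|right]; first by exists i.
  exists (opi (g j)); last by rewrite oadd_opi.
  by apply/olt_OSup; exists j; apply: ole_refl.
move=> [[i h]|[b' /olt_OSup[j hj] h]]; first by exists (inl i).
exists (inr j); apply: ole_trans h _; rewrite -(oreprK b') oadd_opi.
by apply/ole_opi/tadd_le; [apply: tle_refl | apply/ole_opi; rewrite oreprK].
Qed.

Lemma omul0 a : omul a 0 = ozero. Proof. by []. Qed.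

Lemma omulS a n : omul a n.+1 = oadd (omul a n) a.
Proof. by elim/ord_ind_pi: a => x; rewrite !omul_opi oadd_opi. Qed.

Lemma olt_exp b c : olt c (oexp b) <->
  c = ozero \/ exists2 b', olt b' b & exists n, ole c (omul (oexp b') n).
Proof.
elim/ord_ind_pi: b => -[B g]; rewrite oexp_opi /texp -/texp olt_OSup; split.
  move=> [[[j n]|] h]; [right|left].
    exists (opi (g j)); last by exists n; rewrite oexp_opi omul_opi.
    by apply/olt_OSup; exists j; apply: ole_refl.
  by apply: ole_anti => //; apply: ole0.
move=> [->|[b' /olt_OSup[j hj] [n h]]]; first by exists None; apply: ole_refl.
exists (Some (j, n)); apply: ole_trans h _; rewrite -(oreprK b') oexp_opi omul_opi.
by apply/ole_opi/tmul_le/texp_le/ole_opi; rewrite oreprK.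
Qed.

Lemma ord_ext a b : (forall c, olt c a <-> olt c b) -> a = b.
Proof.
move=> h; apply: ole_anti.
  by have [//|/h/olt_irr] := ole_total a b.
by have [//|/h/olt_irr] := ole_total b a.
Qed.

Lemma oadd0 a : oadd a ozero = a.
Proof.
apply: ord_ext => c; rewrite olt_add; split; [move=> [//|[b /olt0//]]|by left].
Qed.

Lemma oadd0o a : oadd ozero a = a.
Proof.
elim/(well_founded_ind olt_wf): a => a IH; apply: ord_ext => c; rewrite olt_add.
split=> [[/olt0//|[b ba]]|ca]; first by rewrite IH// => cb; apply: ole_lt_trans ba.
by right; exists c => //; rewrite IH//; apply: ole_refl.
Qed.

Definition initseg (T : Type) (s t : seq T) : Prop := exists u, t = s ++ u.

Definition MAX (T : Type) (G : set (seq T)) : set (seq T) :=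
  [set t | G t /\ forall s, G s -> initseg t s -> s = t].

Definition oshift (a : ord) (t : seq ord) : seq ord := map (oadd a) t.

(** The function P is represented by its graph, a set of pairs, so that P and
    its domain Gamma are constructed together; its values are rational.  Here
    [G] is the graph for (xi, 1), and the result is the part of the graph for
    (xi, n) over Lambda_{xi,n,i}. *)
Definition lambda_graph (G : set (seq ord * rat)) (xi : ord) (n i : nat) :
    set (seq ord * rat) :=
  [set tp | exists tau : nat -> seq ord,
    [/\ forall j, (1 <= j < i)%N -> MAX (fst @` G) (tau j),
        G (tau i, tp.2) &
        tp.1 = flatten [seq oshift (omul (oexp xi) (n - j)) (tau j) | j <- iota 1 i]]].

Definition gamma_graph (G : set (seq ord * rat)) (xi : ord) (n : nat) :
    set (seq ord * rat) :=
  \bigcup_(i in [set i | (1 <= i <= n)%N]) lambda_graph G xi n i.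

Definition P1_step (xi : ord) (rec : forall zeta, olt zeta xi -> set (seq ord * rat)) :
    set (seq ord * rat) :=
  [set tp |
    [\/ xi = ozero /\ tp = ([:: ozero], 1),
        exists zeta (h : olt zeta xi), xi = osucc zeta /\
          exists n p, [/\ (1 <= n)%N, gamma_graph (rec zeta h) zeta n (tp.1, p) &
                        tp.2 = n%:R^-1 * p] |
        olimit xi /\ exists zeta (h : olt (osucc zeta) xi) t,
          rec (osucc zeta) h (t, tp.2) /\ tp.1 = oshift (oexp zeta) t]].

Definition P1_graph : ord -> set (seq ord * rat) := Fix olt_wf _ P1_step.

Lemma P1_graphE xi : P1_graph xi = P1_step (fun zeta (_ : olt zeta xi) => P1_graph zeta).
Proof.
rewrite /P1_graph Fix_eq// => x f g fg; congr P1_step.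
by apply: functional_extensionality_dep => y; apply: functional_extensionality_dep.
Qed.

Lemma osucc_inj a b : osucc a = osucc b -> a = b.
Proof.
move=> ab; apply: ole_anti; apply/olt_succ.
  by rewrite -ab; apply/olt_succ; apply: ole_refl.
by rewrite ab; apply/olt_succ; apply: ole_refl.
Qed.

Lemma olt_osucc a : olt a (osucc a).
Proof. by apply/olt_succ; apply: ole_refl. Qed.

Lemma ozero_neq_succ a : ozero <> osucc a.
Proof. by move=> e; apply: (@olt0 a); rewrite e; apply: olt_osucc. Qed.

Lemma P1_graph0 : P1_graph ozero = [set ([:: ozero], 1)].
Proof.
rewrite P1_graphE; apply/seteqP; split=> tp; last by constructor 1.
by case=> [[]//|[z [/olt0]]|[[]]].
Qed.

Lemma P1_graphS xi : P1_graph (osucc xi) =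
  [set tp | exists n p, [/\ (1 <= n)%N, gamma_graph (P1_graph xi) xi n (tp.1, p) &
                         tp.2 = n%:R^-1 * p]].
Proof.
rewrite P1_graphE; apply/seteqP; split=> tp.
  by case=> [[/esym/ozero_neq_succ]|[z [_ [/osucc_inj <-]]]|[[_ /(_ xi)]]].
by move=> h; constructor 2; exists xi, (olt_osucc xi).
Qed.

Lemma P1_graph_lim xi : olimit xi -> P1_graph xi =
  [set tp | exists2 zeta, olt zeta xi &
    exists2 t, P1_graph (osucc zeta) (t, tp.2) & tp.1 = oshift (oexp zeta) t].
Proof.
move=> lim; rewrite P1_graphE; apply/seteqP; split=> tp.
  case=> [[xi0]|[z [_ [xiS]]]|[_ [z [h [t [? ?]]]]]].
  - by case: lim.
  - by case: lim => _ /(_ z).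
  - by exists z; [apply: ole_lt_trans h; apply: oltW; apply: olt_osucc | exists t].
move=> [z zxi [t ? ?]]; constructor 3; split=> //.
have h : olt (osucc z) xi.
  have [h|//] := ole_total xi (osucc z); case: lim => _ /(_ z); case.
  apply: ole_anti => //; have [//|/olt_succ xz] := ole_total (osucc z) xi.
  by case: (@olt_irr z); apply: olt_le_trans xz.
by exists z, h, t.
Qed.

Definition Gamma (xi : ord) (n : nat) : set (seq ord) :=
  fst @` gamma_graph (P1_graph xi) xi n.

Definition Lambda (xi : ord) (n i : nat) : set (seq ord) :=
  fst @` lambda_graph (P1_graph xi) xi n i.

Definition Pval (xi : ord) (n : nat) (t : seq ord) : rat :=
  xget 0 [set p | gamma_graph (P1_graph xi) xi n (t, p)].

Lemma gamma_graph1 (G : set (seq ord * rat)) xi : gamma_graph G xi 1 = G.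
Proof.
have sh t : oshift (omul (oexp xi) 0) t = t.
  by rewrite omul0 /oshift; under eq_map do rewrite oadd0o; rewrite map_id.
apply/seteqP; split=> [[t p] [i /= i1 [tau [_]]]|[t p] Gtp].
  have -> : i = 1%N by apply/eqP; rewrite eqn_leq andbC.
  by rewrite /= subnn sh cats0 => ? ->.
exists 1%N => //; exists (fun=> t); split=> //=; last by rewrite subnn sh cats0.
by case=> [|[]].
Qed.

Definition directed (D : Type) (le : D -> D -> Prop) : Prop :=
  [/\ inhabited D, forall u, le u u,
      forall u v w, le u v -> le v w -> le u w &
      forall u v, exists w, le u w /\ le v w].

Definition tails (D : Type) (le : D -> D -> Prop) : set_system D :=
  filter_from setT (fun u0 => [set u | le u0 u]).

Variant scalars := Reals | Complexes.

Definition scalar_field (R : realType) (k : scalars) : numFieldType :=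
  match k with Reals => R | Complexes => R[i] end.

Definition re (R : realType) (k : scalars) : scalar_field R k -> R :=
  match k with Reals => id | Complexes => @complex.Re R end.

Section Alpha.
Variables (R : realType) (k : scalars).
Local Notation F := (scalar_field R k).
Variable X : normedModType F.

(** The weak-star topology is the topology of pointwise convergence, that is,
    the one induced by [{ptws X -> F}]. *)
Definition dual_space : set {ptws X -> F} :=
  [set f | scalar f /\ continuous (f : X -> F)].

Definition weakly_null (D : Type) (le : D -> D -> Prop) (x : D -> X) : Prop :=
  forall f, dual_space f -> f (x u) @[u --> tails le] --> (0 : F).

Definition GammaD (D : Type) (xi : ord) (n : nat) : set (seq (ord * D)) :=
  [set t | Gamma xi n (unzip1 t)].

Definition LambdaD (D : Type) (xi : ord) (n i : nat) : set (seq (ord * D)) :=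
  [set t | Lambda xi n i (unzip1 t)].

Definition weakly_null_tree (D : Type) (le : D -> D -> Prop) (xi : ord) (n : nat)
    (x : seq (ord * D) -> X) : Prop :=
  forall s zeta, s = [::] \/ GammaD xi n s ->
    (forall u, GammaD xi n (rcons s (zeta, u))) ->
    weakly_null le (fun u => x (rcons s (zeta, u))).

(** The non-empty initial segments of [t] are the [take m.+1 t], [m < size t]. *)
Definition zvec (D : Type) (xi : ord) (n i : nat) (x : seq (ord * D) -> X)
    (t : seq (ord * D)) : X :=
  \sum_(m < size t | `[< LambdaD xi n i (take m.+1 t) >])
    ratr (Pval xi n (unzip1 (take m.+1 t))) *: x (take m.+1 t).

(** For a weak-star compact [K] the supremum is attained. *)
Definition rfun (K : set {ptws X -> F}) (x : X) : R :=
  if K == set0 then 0 else sup [set re (f x) | f in K].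

Definition lp_norm (p : \bar R) (n : nat) (a : 'I_n -> F) : R :=
  match p with
  | r%:E => (\sum_(i < n) re `|a i| `^ r) `^ r^-1
  | _ => \big[Num.max/0]_(i < n) re `|a i|
  end.

Definition alpha_n (xi : ord) (p : \bar R) (n : nat) (K : set {ptws X -> F}) : \bar R :=
  ereal_inf [set alpha%:E | alpha in [set alpha : R | 0 < alpha /\
    forall (D : Type) (le : D -> D -> Prop), directed le ->
    forall (a : 'I_n -> F) (x : seq (ord * D) -> X),
      (forall t, GammaD xi n t -> `|x t| <= 1) ->
      weakly_null_tree le xi n x ->
      (ereal_inf [set (rfun K (\sum_(i < n) a i *: zvec xi n i.+1 x t))%:E
                 | t in MAX (GammaD xi n)]
       <= (alpha * lp_norm p a)%:E)%E]].

Definition alpha (xi : ord) (p : \bar R) (K : set {ptws X -> F}) : \bar R :=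
  ereal_sup [set alpha_n xi p n K | n in [set n | (1 <= n)%N]].

Definition abs_convex (A : set {ptws X -> F}) : Prop :=
  forall f g (a b : F), A f -> A g -> `|a| + `|b| <= 1 ->
    A (fun x => a * f x + b * g x).

Definition wstar_abs_co (K : set {ptws X -> F}) : set {ptws X -> F} :=
  closure (smallest abs_convex K) `&` dual_space.

End Alpha.

(* Main.v *)
(** The bound in the definition of alpha_{xi,p,n}(K) says that a player who
    chooses ordinals and weak neighbourhoods of 0, against an opponent who answers
    with points of B_X in these neighbourhoods, can force the final sum into
    {y : Re f(y) <= beta for all f in K}, for each beta > alpha |a|.
    Multiplying the trees by a scalar e with |e| <= 1, the same holds for the
    targets {y : Re f(e y) <= beta for all f in K}.  If the player can force
    two targets A and B, then also their intersection: by induction on xi, a tree of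
    order xi and total weight c can be replaced by m successive ones of weight c / m,
    so the two strategies can be refined to the same tree, and their
    neighbourhoods intersected.  Letting e range over a finite net of the unit disc,
    the player forces |f(y)| <= gamma on K, hence on the hull of K, for
    each gamma > alpha |a|. *)
Require Import Defs.
From mathcomp Require Import all_boot all_order all_algebra.
From mathcomp Require Import complex ring.
From mathcomp Require Import all_classical all_reals all_analysis.

Set Implicit Arguments.
Unset Strict Implicit.
Unset Printing Implicit Defensive.

Import Order.TTheory GRing.Theory Num.Theory.
Import numFieldNormedType.Exports.

Local Open Scope classical_set_scope.
Local Open Scope ring_scope.

Lemma rcons_catl (T : Type) (s : seq T) z u : rcons s z ++ u = s ++ z :: u.
Proof. by rewrite -cats1 -catA. Qed.

(** * Games on weighted trees: renaming of letters, unions and composition *)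

Section Game.
Variables (F : numDomainType) (X : lmodType F) (N : set (set X)).

(** A weighted tree is the graph of a weight function on a set of sequences. *)
Definition wtree (Z : Type) : Type := set (seq Z * F).

(** The position [s] need not be a node, so that the empty starting position is covered too. *)
Definition terminal Z (G : wtree Z) (s : seq Z) : Prop :=
  forall t w, G (t, w) -> initseg s t -> t = s.

(** [win G A s v]: the player who chooses, at each move, a letter and a set of
    [N] can force the final value [v + \sum w *: x] into [A] when the play starts
    at position [s] and the opponent answers with a point [x] of the set. *)
Inductive win Z (G : wtree Z) (A : set X) : seq Z -> X -> Prop :=
| win_end s v : terminal G s -> A v -> win G A s v
| win_move s v z w U : G (rcons s z, w) -> N U ->
    (forall x, U x -> win G A (rcons s z) (v + w *: x)) -> win G A s v.

Definition value Z (G : wtree Z) (A : set X) : set X := win G A [::].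

Definition wfunctional Z (G : wtree Z) : Prop :=
  forall t w w', G (t, w) -> G (t, w') -> w = w'.

Definition wmap Z Z' (f : Z -> Z') (G : wtree Z) : wtree Z' :=
  [set tw | exists2 t, G (t, tw.2) & tw.1 = map f t].

Definition wscale Z (c : F) (G : wtree Z) : wtree Z :=
  [set tw | exists2 w, G (tw.1, w) & tw.2 = c * w].

Definition wcomp Z (G1 G2 : wtree Z) : wtree Z :=
  G1 `|` [set tw | exists t1 t2, [/\ exists w, G1 (t1, w), terminal G1 t1,
                                  G2 (t2, tw.2) & tw.1 = t1 ++ t2]].

Lemma sub_win Z (G : wtree Z) (A B : set X) s :
  A `<=` B -> win G A s `<=` win G B s.
Proof.
move=> AB v; elim=> {s v} [s v sG /AB Bv|s v z w U Gw NU _ IH].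
  exact: win_end.
exact: win_move Gw NU IH.
Qed.

Lemma terminal_ext Z Z' (f : Z -> Z') (G : wtree Z) (G' : wtree Z') s s' :
  (forall z u w, G (s ++ z :: u, w) -> G' (s' ++ map f (z :: u), w)) ->
  (forall z' u' w, G' (s' ++ z' :: u', w) ->
    exists z u, z' :: u' = map f (z :: u) /\ G (s ++ z :: u, w)) ->
  terminal G s <-> terminal G' s'.
Proof.
move=> GG' G'G.
have nilE (T : Type) (r u : seq T) : r ++ u = r -> u = [::].
  by elim: r => //= z r IH [].
split=> sG t w Gt [[|z u] tE]; move: Gt; rewrite {}tE ?cats0//.
  by move=> /G'G[z0 [u0 [_ /sG]]] /(_ (ex_intro _ _ erefl)) /nilE.
by move=> /GG'/sG /(_ (ex_intro _ _ erefl)) /nilE.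
Qed.

(** The rest of a play depends only on the tree strictly above the current position; hence only
    proper extensions [z :: u] are compared, and the two positions may lie in different trees. *)
Lemma win_ext Z Z' (f : Z -> Z') (G : wtree Z) (G' : wtree Z') (A : set X) s s' v :
  injective f ->
  (forall z u w, G (s ++ z :: u, w) -> G' (s' ++ map f (z :: u), w)) ->
  (forall z' u' w, G' (s' ++ z' :: u', w) ->
    exists z u, z' :: u' = map f (z :: u) /\ G (s ++ z :: u, w)) ->
  win G A s v <-> win G' A s' v.
Proof.
move=> finj GG' G'G; split=> W; move: GG' G'G.
  elim: W s' => {s v} [s v sG Av|s v z w U Gw NU _ IH] s' GG' G'G.
    by apply: win_end => //; apply/(terminal_ext GG' G'G).
  have Gw' : G' (rcons s' (f z), w).
    by move: Gw; rewrite -!cats1 => /GG'.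
  apply: (win_move Gw' NU) => x Ux; apply: IH => // z1 u w'.
    by rewrite !rcons_catl => /GG'.
  rewrite !rcons_catl => /G'G[z0 [[|z2 u0] [[/finj<-]// -> ->] Gu]].
  by exists z2, u0; rewrite rcons_catl.
elim: W s => {s' v} [s' v sG Av|s' v z' w U Gw NU _ IH] s GG' G'G.
  by apply: win_end => //; apply/(terminal_ext GG' G'G).
move: (Gw); rewrite -cats1 => /G'G[z [u [e Gsz]]].
case: u e Gsz => // -[zE] Gsz.
rewrite cats1 in Gsz; apply: (win_move Gsz NU) => x Ux; apply: IH => // z1 u w'.
  by rewrite !rcons_catl zE => /GG'.
rewrite !rcons_catl zE => /G'G[z0 [[|z2 u0] [[/finj<-]// -> ->] Gu]].
by exists z2, u0; rewrite rcons_catl.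
Qed.

Lemma win_eq Z (G G' : wtree Z) (A : set X) s s' v :
  (forall z u w, G (s ++ z :: u, w) <-> G' (s' ++ z :: u, w)) ->
  win G A s v <-> win G' A s' v.
Proof.
move=> GG'; apply: (@win_ext _ _ id) => // z u w; rewrite ?map_id => /GG'//.
by exists z, u; rewrite map_id.
Qed.

Lemma value_wmap Z Z' (f : Z -> Z') (G : wtree Z) (A : set X) :
  injective f -> value (wmap f G) A = value G A.
Proof.
move=> finj; apply/seteqP.
have e v : win G A [::] v <-> win (wmap f G) A [::] v.
  apply: (win_ext (f := f)) => // z u w /=; first by exists (z :: u).
  by move=> [t /= Gt e]; case: t e Gt => // z0 u0 -> Gt; exists z0, u0.
by split=> v /e.
Qed.

(** The sets [B i] of possible first letters are disjoint, so the first move selects [i] and the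
    rest is played in [G i]. Non-emptiness ensures that the empty position is not terminal. *)
Lemma value_bigcup Z (I : Type) (D : set I) (G : I -> wtree Z) (B : I -> set Z)
    (A : set X) :
  D !=set0 ->
  (forall i, D i -> G i !=set0) ->
  (forall i t w, D i -> G i (t, w) -> exists z u, t = z :: u /\ B i z) ->
  (forall i j z, D i -> D j -> B i z -> B j z -> i = j) ->
  value (\bigcup_(i in D) G i) A = \bigcup_(i in D) value (G i) A.
Proof.
move=> [i0 Di0] G0 GB Binj.
have nterm i : D i -> ~ terminal (G i) [::].
  move=> Di tG; have [[t w] Gt] := G0 i Di.
  have [z [u [tE _]]] := GB _ _ _ Di Gt.
  by have := tG t w Gt (ex_intro _ t erefl); rewrite tE.
have loc i z w v : D i -> G i ([:: z], w) ->
    win (\bigcup_(i in D) G i) A [:: z] v <-> win (G i) A [:: z] v.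
  move=> Di Gi; apply: win_eq => z' u w'; split=> [[j Dj Gj]|?]; last by exists i.
  have [? [? [[<- _]]]] := GB _ _ _ Di Gi.
  have [? [? [[<- _]]]] := GB _ _ _ Dj Gj.
  by move=> Bj Bi; rewrite (Binj i j z).
apply/seteqP; split=> v.
  rewrite /value => W; inversion W as [s v' tG Av|s v' z w U [i Di Gw] NU IH]; subst.
    case: (nterm _ Di0) => t w Gt; apply: tG; by exists i0; eauto.
  exists i => //; apply: (win_move Gw NU) => x Ux; apply/(loc _ _ _ _ Di Gw); exact: IH.
move=> [i Di W]; inversion W as [s v' tG Av|s v' z w U Gw NU IH]; subst.
  by case: (nterm _ Di).
apply: (@win_move _ _ _ [::] _ z w U); [by exists i| by []|].
by move=> x Ux; apply/(loc _ _ _ _ Di Gw); exact: IH.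
Qed.

Section Comp.
Variables (Z : Type) (G1 G2 : wtree Z) (B : pred Z).
Hypotheses (G10 : G1 !=set0) (G1B : forall t w, G1 (t, w) -> all B t)
  (G2B : forall t w, G2 (t, w) -> all (predC B) t)
  (G2n : forall w, ~ G2 ([::], w)).

Lemma wcompR t1 w1 t2 w : G1 (t1, w1) -> terminal G1 t1 -> G2 (t2, w) ->
  wcomp G1 G2 (t1 ++ t2, w).
Proof. by move=> Gt1 tG1 Gt2; right; exists t1, t2; split => //; exists w1. Qed.

Lemma filter_sep (t1 t2 : seq Z) :
  all B t1 -> all (predC B) t2 -> seq.filter B (t1 ++ t2) = t1.
Proof.
move=> b1 b2; rewrite filter_cat (all_filterP b1) -[RHS]cats0; congr (_ ++ _).
by elim: t2 b2 => //= z t IH /andP[/negbTE -> /IH].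
Qed.

Lemma win_compR (A : set X) t1 w1 v : G1 (t1, w1) -> terminal G1 t1 ->
  win (wcomp G1 G2) A t1 v <-> win G2 A [::] v.
Proof.
move=> Gt1 tG1; apply: win_eq => z u w; split=> [[Gu|]|]; last exact: wcompR Gt1 tG1.
  have /(congr1 size) := tG1 _ _ Gu (ex_intro _ _ erefl).
  by rewrite size_cat /= addnS => /eqP; rewrite -addSn gtn_eqF // ltnS leq_addr.
move=> [t [t2 [[w' Gt] tGt /= Gt2 e]]].
have /(congr1 (seq.filter B)) := e.
rewrite (filter_sep (G1B Gt) (G2B Gt2)) filter_cat (all_filterP (G1B Gt1)) => te.
have := tG1 _ _ Gt; rewrite -te => /(_ (ex_intro _ _ erefl)) te'.
by move: e; rewrite -te te' => /(congr1 (drop (size t1))); rewrite !drop_size_cat// => ->.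
Qed.

(** A play of the composite is a play of [G1] followed by one of [G2] started from the value
    reached. The predicate [B] separates the letters of the two trees, so the passage from one to
    the other can be read off the sequence. *)
Lemma value_wcomp (A : set X) :
  value (wcomp G1 G2) A = value G1 (value G2 A).
Proof.
have terminalG1 s : s = [::] \/ (exists w, G1 (s, w)) -> terminal G1 s ->
    exists w, G1 (s, w).
  move=> [->|//] tG; have [[t w] Gt] := G10; exists w.
  by move: (Gt); rewrite (tG _ _ Gt) //; exists t.
apply/seteqP; split=> v.
  suff H s u : s = [::] \/ (exists w, G1 (s, w)) -> win (wcomp G1 G2) A s u ->
    win G1 (value G2 A) s u by apply: H; left.
  move=> + W; elim: W => {s u} [s u sG Au|s u z w U Gw NU W IH] Gs.
    have tG1 : terminal G1 s by move=> t w Gt; apply: (sG t w); left.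
    have [w Gsw] := terminalG1 _ Gs tG1.
    by apply: win_end => //; apply/(win_compR _ _ Gsw tG1)/win_end.
  have [tG1|ntG1] := pselect (terminal G1 s).
    have [w' Gsw] := terminalG1 _ Gs tG1.
    by apply: win_end => //; apply/(win_compR _ _ Gsw tG1); apply: win_move Gw NU W.
  (* Before the end of [G1] a move cannot enter [G2]: otherwise [s] would be [t1 ++ t2] with [t1]
     terminal, and the letters of [s] would force [t2] to be empty. *)
  have Gw1 : G1 (rcons s z, w).
    case: Gw => // -[t1 [t2 [[w1 Gt1] tGt1 /= Gt2]]].
    case/lastP: t2 Gt2 => [/G2n//|t2 z2] Gt2.
    rewrite -rcons_cat => /rcons_inj[sE _]; case: ntG1.
    case: Gs => [s0|[w2 Gs]]; first by case: t1 sE tGt1 {Gt1}; rewrite s0.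
    move: (G1B Gs) (G2B Gt2); rewrite sE all_cat all_rcons /= => /andP[_ Bt2].
    case: t2 Bt2 sE {Gt2} => [|z3 t2] /=; first by rewrite cats0.
    by move=> /andP[-> _] _ /andP[].
  by apply: (win_move Gw1 NU) => x Ux; apply: IH => //; right; exists w.
suff H s u : s = [::] \/ (exists w, G1 (s, w)) ->
  win G1 (value G2 A) s u -> win (wcomp G1 G2) A s u by apply: H; left.
move=> + W; elim: W => {s u} [s u sG Au|s u z w U Gw NU W IH] Gs.
  by have [w Gsw] := terminalG1 _ Gs sG; apply/(win_compR _ _ Gsw sG).
apply: (@win_move _ _ _ _ _ z w U) => // [|x Ux]; first by left.
by apply: IH => //; right; exists w.
Qed.

End Comp.
End Game.

(** * Weak neighbourhoods of 0, and weakly null trees as strategies of the opponent *)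

Lemma filter_tails (D : Type) (le : D -> D -> Prop) : directed le -> Filter (tails le).
Proof.
move=> [[u0] _ letrans ledir]; apply: filter_from_filter; first by exists u0.
move=> u v _ _; have [w [uw vw]] := ledir u v; exists w => // x wx.
by split; apply: letrans wx.
Qed.

Section NormedGame.
Variables (R : realType) (k : scalars).
Local Notation F := (scalar_field R k).
Variable X : normedModType F.
Local Notation functionals := (seq {ptws X -> F}).

(** Basic weak neighbourhoods of 0 relative to the unit ball. The bound 1 loses nothing, since
    functionals can be rescaled; members of [S] outside the dual impose no condition, so every
    finite list is an admissible index. *)
Definition wnbhs (S : functionals) : set X :=
  [set x | `|x| <= 1 /\ forall f, f \in S -> @dual_space R k X f -> `|f x| < 1].

Definition incl_le (S S' : functionals) : Prop := forall f, f \in S -> f \in S'.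

Lemma directed_incl : directed incl_le.
Proof.
split=> [|S f//|S S' S'' h h' f /h/h'//|S S']; first by constructor; exact: [::].
by exists (S ++ S'); split=> f fS; rewrite mem_cat fS ?orbT.
Qed.

Lemma wnbhs_cat S S' : wnbhs (S ++ S') = wnbhs S `&` wnbhs S'.
Proof.
apply/seteqP; split=> x [x1 h].
  by split; split=> // f fS; apply: h; rewrite mem_cat fS ?orbT.
by case: h => _ h'; split=> [|f]; [case: x1|rewrite mem_cat => /orP[]; [case: x1 => _; exact|exact: h']].
Qed.

Lemma wnbhs0 S : wnbhs S 0.
Proof.
split=> [|f _ [flin _]]; first by rewrite normr0 ler01.
have := flin (-1) 0 0; rewrite scaler0 addr0 mulN1r addNr => ->.
by rewrite normr0 ltr01.
Qed.

Local Notation win := (win (range wnbhs)).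
Local Notation value := (value (range wnbhs)).

Variables (G : wtree F ord) (wt : seq ord -> F).
Hypothesis wtE : forall t w, G (t, w) -> wt t = w.
Let node t := exists w, G (t, w).

Definition bsum D (x : seq (ord * D) -> X) (t : seq (ord * D)) : X :=
  \sum_(m < size t) wt (unzip1 (take m.+1 t)) *: x (take m.+1 t).

Lemma bsum_rcons D (x : seq (ord * D) -> X) s a :
  bsum x (rcons s a) = bsum x s + wt (unzip1 (rcons s a)) *: x (rcons s a).
Proof.
rewrite /bsum size_rcons big_ord_recr /=.
rewrite [take _.+1 (rcons s a)]take_oversize ?size_rcons//; congr (_ + _).
by apply: eq_bigr => i _; rewrite -cats1 takel_cat.
Qed.

(** The net is eventually small on each functional of [S]; directedness combines these finitely many
    conditions. *)
Lemma tails_exists D (le : D -> D -> Prop) (x : D -> X) S :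
  directed le -> (forall u, `|x u| <= 1) -> weakly_null le x ->
  exists u, wnbhs S (x u).
Proof.
move=> dir x1 wx; have tails_filter := filter_tails dir.
have [[u0] lerefl letrans ledir] := dir.
have [u] : exists u, forall f, f \in S -> @dual_space R k X f -> `|f (x u)| < 1.
  suff [u ux] : exists u, forall u', le u u' ->
    forall f, f \in S -> @dual_space R k X f -> `|f (x u')| < 1.
    by exists u; apply: ux.
  elim: S => [|g S [u IH]]; first by exists u0.
  have [dg|ndg] := pselect (@dual_space R k X g); last first.
    by exists u => u' /IH h f; rewrite inE => /orP[/eqP-> /ndg//|]; apply: h.
  have /cvgrPdist_lt h := wx g dg.
  have [v _ hv] := h 1 ltr01.
  have [w [uw vw]] := ledir u v; exists w => u' wu' f; rewrite inE => /orP[/eqP-> _|fS].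
    by have := hv u' (letrans _ _ _ vw wu'); rewrite /= sub0r normrN.
  by apply: IH => //; apply: letrans wu'.
by exists u; split.
Qed.

(** The tree acts as opponent: whenever the winning strategy names a letter and a neighbourhood,
    some index [u] gives a vector of the tree in that neighbourhood. Following these indices yields
    the branch. *)
Lemma win_branch D (le : D -> D -> Prop) (x : seq (ord * D) -> X) (A : set X) :
  directed le ->
  (forall t, node (unzip1 t) -> `|x t| <= 1) ->
  (forall s z, s = [::] \/ node (unzip1 s) -> node (rcons (unzip1 s) z) ->
    weakly_null le (fun u => x (rcons s (z, u)))) ->
  value G A 0 ->
  exists t, [/\ t = [::] \/ node (unzip1 t), terminal G (unzip1 t) & A (bsum x t)].
Proof.
move=> dir x1 wx.
have H s v : win G A s v ->
    forall t, unzip1 t = s -> t = [::] \/ node (unzip1 t) -> bsum x t = v ->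
    exists t, [/\ t = [::] \/ node (unzip1 t), terminal G (unzip1 t) & A (bsum x t)].
  elim=> {s v} [s v sG Av|s v z w _ Gw [S _ <-] W IH] t tE Gt tv.
    by exists t; rewrite tE tv; split=> //; rewrite -tE.
  have nz : node (rcons (unzip1 t) z) by exists w; rewrite tE.
  have nzu u : unzip1 (rcons t (z, u)) = rcons s z by rewrite /unzip1 map_rcons -tE.
  have [u /IH/(_ (rcons t (z, u)))] :=
    tails_exists S dir (fun u => x1 (rcons t (z, u))
      (ex_intro _ w (eq_ind_r (fun r => G (r, w)) Gw (nzu u)))) (wx t z Gt nz).
  apply; [by []|by right; exists w; rewrite nzu|].
  by rewrite bsum_rcons tv nzu (wtE Gw).
move=> W; apply: (H _ _ W [::]) => //; first by left.
by rewrite /bsum big_ord0.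
Qed.

Section Strategy.
Variable A : set X.

(** An answer after which the player still cannot win, if there is one; the default 0 lies in every
    neighbourhood. *)
Definition reply (s : seq ord) (v : X) (z : ord) (S : functionals) : X :=
  xget 0 [set y | wnbhs S y /\ ~ win G A (rcons s z) (v + wt (rcons s z) *: y)].

(** The play is stored backwards. *)
Fixpoint reply_sum (r : seq (ord * functionals)) : X :=
  if r is (z, L) :: r' then
    reply_sum r' + wt (rcons (unzip1 (rev r')) z) *:
                   reply (unzip1 (rev r')) (reply_sum r') z L
  else 0.

(** The strategy of the opponent as a tree over the directed set of finite lists: the second
    component of a letter is the neighbourhood chosen by the player. *)
Definition reply_tree (t : seq (ord * functionals)) : X :=
  if rev t is (z, L) :: r then reply (unzip1 (rev r)) (reply_sum r) z L else 0.

Lemma reply_wnbhs s v z S : wnbhs S (reply s v z S).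
Proof. by rewrite /reply; case: xgetP => [y _ []//|_]; apply: wnbhs0. Qed.

Lemma reply_tree_rcons s z S :
  reply_tree (rcons s (z, S)) = reply (unzip1 s) (reply_sum (rev s)) z S.
Proof. by rewrite /reply_tree rev_rcons revK. Qed.

Lemma bsum_reply_tree t : bsum reply_tree t = reply_sum (rev t).
Proof.
elim/last_ind: t => [|s [z S] IH]; first by rewrite /bsum big_ord0.
by rewrite bsum_rcons IH rev_rcons /= revK reply_tree_rcons /unzip1 map_rcons.
Qed.

Lemma reply_tree_le1 t : `|reply_tree t| <= 1.
Proof.
elim/last_ind: t => [|s [z S] _]; first by rewrite /reply_tree normr0 ler01.
by rewrite reply_tree_rcons; case: (reply_wnbhs (unzip1 s) (reply_sum (rev s)) z S).
Qed.

Lemma reply_tree_weakly_null s z :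
  weakly_null incl_le (fun S => reply_tree (rcons s (z, S))).
Proof.
have tails_filter := filter_tails directed_incl.
move=> f [flin fcont]; apply/cvgrPdist_lt => e e0.
(* Replies only obey the bound 1, so [f] is rescaled: a list containing [g] forces the value of [f]
   below [e] in modulus. *)
pose g : {ptws X -> F} := fun y => e^-1 * f y.
have dg : @dual_space R k X g.
  split; first by move=> a y y'; rewrite /g flin mulrDr /= mulrCA.
  by move=> y; apply: cvgMl_tmp; apply: fcont.
exists [:: g] => // S gS; rewrite /= sub0r normrN reply_tree_rcons.
have [_ /(_ g (gS _ (mem_head _ _)) dg)] := reply_wnbhs (unzip1 s) (reply_sum (rev s)) z S.
by rewrite /g normrM normfV (gtr0_norm e0) mulrC ltr_pdivrMr// mul1r.
Qed.

(** Against these replies no position reached is winning for the player, by induction on its length;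
    in particular no terminal sum lies in [A]. *)
Lemma reply_tree_loses : (forall s z, node (rcons s z) -> s = [::] \/ node s) ->
  ~ value G A 0 ->
  forall t, node (unzip1 t) -> terminal G (unzip1 t) -> ~ A (bsum reply_tree t).
Proof.
move=> prefix nW.
have H t : t = [::] \/ node (unzip1 t) -> ~ win G A (unzip1 t) (reply_sum (rev t)).
  elim/last_ind: t => [//|s [z S] IH] [/(congr1 size)|]; first by rewrite size_rcons.
  rewrite /unzip1 map_rcons -/(unzip1 s) => nz.
  have /IH nWs : s = [::] \/ node (unzip1 s).
    by have [|] := prefix _ _ nz; [case: (s); [left|]|right].
  (* If every answer in [wnbhs S] led to a win, then the move [z], [S] would already win from
     [s]. *)
  have [w Gw] := nz; rewrite rev_rcons /= revK /reply; case: xgetP => [y _ []//|none].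
  move=> _; apply: nWs; apply: (win_move Gw) => [|y Sy]; first by exists S.
  by apply: contrapT => nWy; apply: (none y); split; rewrite ?(wtE Gw).
move=> t Gt tG; rewrite bsum_reply_tree => At; apply: (H t); first by right.
exact: win_end.
Qed.

End Strategy.
End NormedGame.

(** * Ordinal arithmetic and transfinite induction *)

Lemma olt_trans b a c : olt a b -> olt b c -> olt a c.
Proof. by move=> ab /oltW; apply: olt_le_trans. Qed.

Lemma oadd_le a a' b b' : ole a a' -> ole b b' -> ole (oadd a b) (oadd a' b').
Proof.
elim/ord_ind_pi: a => a; elim/ord_ind_pi: a' => a'.
elim/ord_ind_pi: b => b; elim/ord_ind_pi: b' => b'.
by rewrite !oadd_opi !ole_opi; apply: tadd_le.
Qed.

Lemma omul_le a a' n : ole a a' -> ole (omul a n) (omul a' n).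
Proof.
elim/ord_ind_pi: a => a; elim/ord_ind_pi: a' => a'.
by rewrite !omul_opi !ole_opi; apply: tmul_le.
Qed.

Lemma oexp_le a b : ole a b -> ole (oexp a) (oexp b).
Proof.
elim/ord_ind_pi: a => a; elim/ord_ind_pi: b => b.
by rewrite !oexp_opi !ole_opi; apply: texp_le.
Qed.

Lemma ole_oaddr a b : ole a (oadd a b).
Proof. by rewrite -[X in ole X _]oadd0; apply: oadd_le (ole_refl _) (ole0 _). Qed.

Lemma olt_oadd a b c : olt b c -> olt (oadd a b) (oadd a c).
Proof. by move=> bc; apply/olt_add; right; exists b => //; apply: ole_refl. Qed.

Lemma oadd_inj a : injective (oadd a).
Proof.
move=> b c bc; have nlt := @olt_irr (oadd a c).
have [bc'|/(@olt_oadd a)] := ole_total b c; last by rewrite bc.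
have [cb'|/(@olt_oadd a)] := ole_total c b; last by rewrite bc.
exact: ole_anti.
Qed.

Lemma oadd_assoc_le a b c : ole (oadd a (oadd b c)) (oadd (oadd a b) c).
Proof.
elim/(well_founded_ind olt_wf): c => c IH.
have [//|h] := ole_total (oadd a (oadd b c)) (oadd (oadd a b) c).
suff /olt_irr : olt (oadd (oadd a b) c) (oadd (oadd a b) c) by [].
move: h => /olt_add[h|[e /olt_add[eb|[c' c'c e_le]] h]].
- exact: olt_le_trans (olt_le_trans h (ole_oaddr a b)) (ole_oaddr _ c).
- apply: olt_le_trans (ole_oaddr (oadd a b) c).
  exact: ole_lt_trans h (olt_oadd a eb).
- apply: (ole_lt_trans h); apply: ole_lt_trans (olt_oadd (oadd a b) c'c).
  by apply: ole_trans (IH _ c'c); apply: oadd_le => //; apply: ole_refl.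
Qed.

(** Moves the extra summand from the left to the right, where [omul] adds it. This keeps omega^zeta
    + Gamma_{zeta+1,1} below omega^(zeta+1). *)
Lemma oadd_omul_le a n : ole (oadd a (omul a n)) (omul a n.+1).
Proof.
elim: n => [|n IH]; first by rewrite omul0 oadd0 omulS oadd0o; apply: ole_refl.
rewrite omulS; apply: ole_trans (oadd_assoc_le _ _ _) _.
by rewrite [X in ole _ X]omulS; apply: oadd_le => //; apply: ole_refl.
Qed.

Lemma omul_le_nat a m n : (m <= n)%N -> ole (omul a m) (omul a n).
Proof.
elim: n => [|n IH]; first by rewrite leqn0 => /eqP ->; apply: ole_refl.
rewrite leq_eqVlt => /orP[/eqP->|/IH h]; first exact: ole_refl.
by rewrite omulS; apply: ole_trans h (ole_oaddr _ _).
Qed.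

Lemma olt_oexp_succ a b : olt a (oexp (osucc b)) -> exists n, ole a (omul (oexp b) n).
Proof.
move=> /olt_exp[->|[b' /olt_succ b'b [n an]]]; first by exists 0%N; apply: ole0.
by exists n; apply: ole_trans an (omul_le n (oexp_le b'b)).
Qed.

Lemma olt_oexp a b n : olt a b -> olt (omul (oexp a) n) (oexp b).
Proof.
move=> ab; apply/olt_exp; right; exists a => //; exists n; exact: ole_refl.
Qed.

Lemma ord_ind (P : ord -> Prop) : P ozero -> (forall a, P a -> P (osucc a)) ->
  (forall a, olimit a -> (forall b, olt b a -> P b) -> P a) -> forall a, P a.
Proof.
move=> P0 PS Pl; elim/(well_founded_ind olt_wf) => a IH.
have [->//|a0] := pselect (a = ozero).
have [[b ab]|aS] := pselect (exists b, a = osucc b).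
  by rewrite ab; apply/PS/IH; rewrite ab; apply: olt_osucc.
by apply: Pl => //; split=> // b ab; apply: aS; exists b.
Qed.

Lemma olimit_succ a b : olimit a -> olt b a -> olt (osucc b) a.
Proof.
move=> [_ aS] ba; have [ab|//] := ole_total a (osucc b).
case: (aS b); apply: ole_anti => //.
by have [//|/olt_succ/(ole_lt_trans)/(_ ba)/olt_irr] := ole_total (osucc b) a.
Qed.

Lemma olimit_gt0 a : olimit a -> olt ozero a.
Proof.
move=> [a0 _]; have [h|//] := ole_total a ozero.
by case: a0; apply: ole_anti h (ole0 a).
Qed.

(** * The trees Gamma_{xi,n} as composites and unions of smaller trees *)

Section Trees.
Variable F : numFieldType.

(** [P1tree xi] is the graph of P_{xi,1}; for a sequence [a] of length n,
    [Ptree xi a] is the tree Gamma_{xi,n}, on which the weight over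
    Lambda_{xi,n,i} is [a_i] times P_{xi,n}. *)
Definition P1tree (xi : ord) : wtree F ord :=
  [set tw | exists2 p, P1_graph xi (tw.1, p) & tw.2 = ratr p].

Fixpoint Ptree (xi : ord) (a : seq F) : wtree F ord :=
  if a is c :: a' then
    wcomp (wmap (oadd (omul (oexp xi) (size a'))) (wscale c (P1tree xi))) (Ptree xi a')
  else set0.

Definition wmax Z (G : wtree F Z) (t : seq Z) : Prop :=
  (exists w, G (t, w)) /\ terminal G t.

Lemma wmap_wscale_P1tree (f : ord -> ord) xi (c w : F) t :
  wmap f (wscale c (P1tree xi)) (t, w) <->
  exists s p, [/\ P1_graph xi (s, p), t = map f s & w = c * ratr p].
Proof.
split=> [[s [w' [p /= sp ->] /= ->] ->]|[s [p [sp -> ->]]]]; first by exists s, p.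
by exists s => //=; exists (ratr p) => //; exists p.
Qed.

Lemma wmax_P1tree (f : ord -> ord) xi (c : F) t : injective f ->
  wmax (wmap f (wscale c (P1tree xi))) t <->
  exists2 s, MAX (fst @` P1_graph xi) s & t = map f s.
Proof.
move=> finj; split=> [[[w /wmap_wscale_P1tree[s [p [sp -> _]]]] tT]|].
  exists s => //; split=> [|s' [[s'' p'] /= sp' <-] [u s''E]]; first by exists (s, p).
  apply: (inj_map finj); apply: (tT _ (c * ratr p')).
    by apply/wmap_wscale_P1tree; exists s'', p'.
  by exists (map f u); rewrite s''E map_cat.
move=> [s [[[s' p] /= sp s's] smax] ->]; rewrite {}s's in sp; split.
  by exists (c * ratr p); apply/wmap_wscale_P1tree; exists s, p.
move=> t' w' /wmap_wscale_P1tree[s'' [p' [sp' -> _]]] [u s''E]; congr map.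
apply: smax; first by exists (s'', p').
exists (drop (size s) s''); rewrite -[LHS](cat_take_drop (size s)); congr (_ ++ _).
by apply: (inj_map finj); rewrite map_take s''E take_size_cat ?size_map.
Qed.

(** Identifies the recursive composite with the explicit description of Lambda_{xi,n,i}: the first
    factor gives i = 1, and a node of the tail with index i becomes one with index i + 1. *)
Lemma PtreeE xi (a : seq F) t w : Ptree xi a (t, w) <->
  exists i p, [/\ (1 <= i <= size a)%N,
    lambda_graph (P1_graph xi) xi (size a) i (t, p) & w = nth 0 a i.-1 * ratr p].
Proof.
elim: a t w => [|c a IH] t w.
  by split=> [//|[i [p [+ _ _]]]]; rewrite /= leqn0; case: i.
have finj := @oadd_inj (omul (oexp xi) (size a)).
rewrite [Ptree _ _]/= /wcomp; split=> [[]|].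
- move=> /wmap_wscale_P1tree[s [p [sp -> ->]]]; exists 1%N, p; split=> //.
  exists (fun=> s); split=> //=; first by case=> [|[]].
  by rewrite cats0 subSS subn0.
- move=> [t1 [t2 [Gt1 tGt1 /= /IH[i [p [/andP[i1 ia] [tau [tau1 taui t2E]] ->]]] ->]]].
  rewrite /= in t2E.
  have [s smax ->] := iffLR (wmax_P1tree _ _ _ finj) (conj Gt1 tGt1).
  exists i.+1, p; split=> //; last by case: i i1 {ia tau1 taui t2E}.
  (* The segment [s] is put in front as number 1 and the segments [tau] move up by one; the shifts
     agree, as n + 1 - (j + 1) = n - j. *)
  exists (fun j => if j is j'.+1 then if j' is _.+1 then tau j' else s else s).
  split.
  + by case=> [//|[//|j]] /=; rewrite ltnS => ji; apply: tau1.
  + by case: i i1 taui {ia tau1 t2E}.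
  + rewrite /= subSS subn0; congr (_ ++ _); rewrite t2E /=; congr flatten.
    rewrite -[2%N]/(1 + 1)%N iotaDl -map_comp; apply/eq_in_map => j.
    by rewrite mem_iota => /andP[j1 _] /=; rewrite add1n subSS; case: j j1.
move=> [i [p [/andP[i1 ia] [tau [tau1 taui tE]] ->]]].
case: i i1 ia tau1 taui tE => [//|[|i]] _ ia tau1 taui tE.
  left; apply/wmap_wscale_P1tree; exists (tau 1%N), p; split=> //.
  by move: tE; rewrite /= cats0 subSS subn0.
right; exists (oshift (omul (oexp xi) (size a)) (tau 1%N)).
exists (flatten [seq oshift (omul (oexp xi) (size a - j)) (tau j.+1) | j <- iota 1 i.+1]).
have [Gt1 tGt1] := iffRL (wmax_P1tree xi c _ finj)
  (ex_intro2 _ _ (tau 1%N) (tau1 1%N isT) erefl).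
split=> //=.
  apply/IH; exists i.+1, p; split=> //.
  by exists (fun j => tau j.+1); split=> // j /andP[_ ji]; apply: tau1.
move: tE; rewrite /= subSS subn0 => ->; congr (_ ++ (_ ++ _)).
congr flatten; rewrite -[3%N]/(1 + 2)%N iotaDl -map_comp.
by apply: eq_map => j /=; rewrite subSS.
Qed.

(** The factor 1/n in P_{xi+1,1} is spread evenly over the n segments, which gives n equal
    coefficients. *)
Lemma wscale_P1treeS xi c : wscale c (P1tree (osucc xi)) =
  \bigcup_(n in [set n | (0 < n)%N]) Ptree xi (nseq n (c / n%:R)).
Proof.
have cE n q : c * ratr (n%:R^-1 * q) = c / n%:R * ratr q.
  by rewrite rmorphM fmorphV rmorph_nat mulrA.
apply/seteqP; split=> [[t w]|[t w] [n /= n0 /PtreeE]].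
  move=> [w' [p]]; rewrite P1_graphS /= => -[n [q [n0 [i /andP[i1 iN] tq] ->]] -> ->].
  exists n => //; apply/PtreeE; exists i, q; rewrite size_nseq i1; split=> //.
  by rewrite nth_nseq prednK// iN cE.
rewrite size_nseq => -[i [p [/andP[i1 iN] tp ->]]].
exists (ratr (n%:R^-1 * p)); last by rewrite /= nth_nseq prednK// iN cE.
exists (n%:R^-1 * p) => //=; rewrite P1_graphS; exists n, p; split=> //=.
by exists i; rewrite //= i1.
Qed.

Lemma wscale_P1tree_lim xi c : olimit xi -> wscale c (P1tree xi) =
  \bigcup_(zeta in [set zeta | olt zeta xi])
    wmap (oadd (oexp zeta)) (wscale c (P1tree (osucc zeta))).
Proof.
move=> lim; apply/seteqP; split=> [[t w] [w' [p]]|[t w] [zeta zxi]].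
  rewrite P1_graph_lim// => -[zeta zxi [s sp /= ->]] /= -> ->.
  by exists zeta => //; apply/wmap_wscale_P1tree; exists s, p.
move=> /wmap_wscale_P1tree[s [p [sp -> ->]]].
exists (ratr p) => //; exists p => //=; rewrite P1_graph_lim//.
by exists zeta => //; exists s.
Qed.

Lemma wscale1 Z (G : wtree F Z) : wscale 1 G = G.
Proof.
apply/seteqP; split=> [[t w] [w' /= Gt ->]|[t w] Gt]; first by rewrite mul1r.
by exists w; rewrite //= mul1r.
Qed.

(** What the game lemmas ask of a tree. The set [B] confines its letters, so that components of
    unions and composites can be told apart. *)
Record regular (B : set ord) (G : wtree F ord) : Prop := {
  regular_nil : forall w, ~ G ([::], w);
  regular_all : forall t w, G (t, w) -> all (fun z => `[< B z >]) t;
  regular_fun : wfunctional G;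
  regular_prefix : forall s z w, G (rcons s z, w) -> s = [::] \/ exists w', G (s, w') }.

Lemma regular_cons B G t w : regular B G -> G (t, w) -> exists z u, t = z :: u /\ B z.
Proof.
move=> rG Gt; case: t Gt => [/(regular_nil rG)//|z u] Gt; exists z, u; split=> //.
by have /andP[/asboolP] := regular_all rG Gt.
Qed.

Lemma sub_regular B B' G : B `<=` B' -> regular B G -> regular B' G.
Proof.
move=> BB' rG; split; [exact: regular_nil rG| |exact: regular_fun rG|
  exact: regular_prefix rG].
move=> t w /(regular_all rG); apply: sub_all => z /asboolP Bz.
exact/asboolP/BB'.
Qed.

Lemma regular_wscale B c G : regular B G -> regular B (wscale c G).
Proof.
move=> rG; split=> [w [w' /(regular_nil rG)]//|t w [w' /(regular_all rG)]//| |].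
  by move=> t w w' [u /= Gu ->] [u' /= Gu' ->]; rewrite (regular_fun rG Gu Gu').
move=> s z w [w' /= /(regular_prefix rG)[|[w'' Gs] _]]; first by left.
by right; exists (c * w''), w''.
Qed.

Lemma regular_wmap B f G : injective f -> regular B G -> regular (f @` B) (wmap f G).
Proof.
move=> finj rG; split.
- by move=> w [[/(regular_nil rG)//|]].
- move=> _ w [t /= /(regular_all rG) Bt ->]; rewrite all_map; apply: sub_all Bt.
  by move=> z /asboolP Bz; apply/asboolP; exists z.
- move=> _ w w' [t /= Gt ->] [t' /= Gt' /(inj_map finj) tt']; move: Gt'.
  by rewrite -tt'; apply: (regular_fun rG Gt).
- move=> s z w [t /= + e]; case/lastP: t e => [/(congr1 size)|t z']; first by rewrite size_rcons.
  rewrite map_rcons => /rcons_inj[-> _] /(regular_prefix rG)[->|[w' Gt]]; first by left.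
  by right; exists w', t.
Qed.

(** Disjoint alphabets make the splitting [t1 ++ t2] unique, so weights remain single-valued. *)
Lemma regular_wcomp B1 B2 (B : set ord) G1 G2 : B1 `&` B2 `<=` set0 ->
  B1 `|` B2 `<=` B -> regular B1 G1 -> regular B2 G2 -> regular B (wcomp G1 G2).
Proof.
move=> B12 BB r1 r2.
have b2 t w : G2 (t, w) -> all (predC (fun z => `[< B1 z >])) t.
  move=> /(regular_all r2); apply: sub_all => z /asboolP B2z /=.
  by apply/asboolP => B1z; apply: (B12 z).
have right_neq t w t1 t2 w2 : G1 (t, w) -> G2 (t2, w2) -> t = t1 ++ t2 -> False.
  move=> /(regular_all r1) + Gt2 tE; rewrite tE all_cat => /andP[_].
  have := b2 _ _ Gt2; case: t2 Gt2 {tE} => [/(regular_nil r2)//|z t2] _ /=.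
  by move=> /andP[/negbTE ->].
split.
- move=> w [/(regular_nil r1)//|[t1 [t2 [_ _ /= Gt2]]]].
  by case: t2 Gt2 => [/(regular_nil r2)//|z t2 _]; case: t1.
- move=> t w [/(regular_all r1)|[t1 [t2 [[w1 Gt1] _ /= Gt2 ->]]]].
    by apply: sub_all => z /asboolP h; apply/asboolP/BB; left.
  rewrite all_cat; apply/andP; split.
    by apply: sub_all (regular_all r1 Gt1) => z /asboolP h; apply/asboolP/BB; left.
  by apply: sub_all (regular_all r2 Gt2) => z /asboolP h; apply/asboolP/BB; right.
- move=> t w w' [Gt|[t1 [t2 [[w1 Gt1] _ /= Gt2 tE]]]].
    move=> [/(regular_fun r1 Gt)//|[t1 [t2 [_ _ /= Gt2 tE]]]].
    by case: (right_neq _ _ _ _ _ Gt Gt2 tE).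
  move=> [Gt|[t1' [t2' [[w1' Gt1'] _ /= Gt2' tE']]]].
    by case: (right_neq _ _ _ _ _ Gt Gt2 tE).
  have e1 : t1 = t1'.
    rewrite -(filter_sep (regular_all r1 Gt1) (b2 _ _ Gt2)) -tE tE'.
    by rewrite (filter_sep (regular_all r1 Gt1') (b2 _ _ Gt2')).
  apply: (regular_fun r2 Gt2); suff -> : t2 = t2' by [].
  by rewrite -(drop_size_cat t2 (erefl (size t1))) -tE tE' e1 drop_size_cat.
- move=> s z w [/(regular_prefix r1)[|[w' Gs]]|[t1 [t2 [Gt1 tGt1 /= Gt2 sE]]]].
  + by left.
  + by right; exists w'; left.
  + case/lastP: t2 Gt2 sE => [/(regular_nil r2)//|t2 z'] Gt2.
    rewrite -rcons_cat => /rcons_inj[-> _]; right.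
    have [->|[w' Gt2']] := regular_prefix r2 Gt2.
      by rewrite cats0; have [w' ?] := Gt1; exists w'; left.
    by exists w'; right; exists t1, t2.
Qed.

Lemma regular_bigcup (I : Type) (D : set I) (G : I -> wtree F ord)
    (B : I -> set ord) (B' : set ord) :
  (forall i j z, D i -> D j -> B i z -> B j z -> i = j) ->
  (forall i, D i -> regular B' (G i)) ->
  (forall i t w, D i -> G i (t, w) -> exists z u, t = z :: u /\ B i z) ->
  regular B' (\bigcup_(i in D) G i).
Proof.
move=> Binj rG GB; split.
- by move=> w [i Di /(regular_nil (rG i Di))].
- by move=> t w [i Di /(regular_all (rG i Di))].
- move=> t w w' [i Di Gi] [j Dj Gj].
  have [z [u [tE Biz]]] := GB _ _ _ Di Gi.
  have [z' [u' [tE' Bjz]]] := GB _ _ _ Dj Gj.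
  move: tE'; rewrite tE => -[zz' _]; rewrite -zz' in Bjz.
  rewrite -(Binj _ _ _ Di Dj Biz Bjz) in Gj.
  exact: (regular_fun (rG i Di) Gi Gj).
- move=> s z w [i Di /(regular_prefix (rG i Di))[|[w' Gs]]]; first by left.
  by right; exists w', i.
Qed.

(** * Disjoint ordinal intervals that locate the letters, and regularity of the trees *)

Definition ointerval (a b : ord) : set ord := [set z | ole a z /\ olt z b].

Lemma ointerval_inj (I : Type) (D : set I) (a b : I -> ord) i j z :
  (forall i j, D i -> D j -> i = j \/ ole (b i) (a j) \/ ole (b j) (a i)) ->
  D i -> D j -> ointerval (a i) (b i) z -> ointerval (a j) (b j) z -> i = j.
Proof.
move=> h Di Dj [aiz zbi] [ajz zbj]; have [//|[ba|ba]] := h _ _ Di Dj.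
  case: (@olt_irr z); exact: olt_le_trans (olt_le_trans zbi ba) ajz.
by case: (@olt_irr z); exact: olt_le_trans (olt_le_trans zbj ba) aiz.
Qed.

(** Contains the first letters of Gamma_{xi,n}, which come from omega^xi (n-1) + Gamma_{xi,1}; the
    first letter thus reveals n. *)
Definition block xi (n : nat) : set ord :=
  ointerval (omul (oexp xi) n.-1) (omul (oexp xi) n).

Lemma block_inj xi i j z : (0 < i)%N -> (0 < j)%N -> block xi i z -> block xi j z -> i = j.
Proof.
apply: (@ointerval_inj _ [set n | (0 < n)%N] (fun n => omul (oexp xi) n.-1)
  (fun n => omul (oexp xi) n)) => {}i {}j /= i0 j0.
have [ij|ji|->] := ltngtP i j; last by left.
  by right; left; apply: omul_le_nat; rewrite -ltnS prednK.
by right; right; apply: omul_le_nat; rewrite -ltnS prednK.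
Qed.

(** Contains the letters of omega^zeta + Gamma_{zeta+1,1}, the component of index zeta in a limit
    tree. *)
Definition limit_block zeta : set ord := ointerval (oexp zeta) (oexp (osucc zeta)).

Lemma limit_block_inj xi i j z : olt i xi -> olt j xi ->
  limit_block i z -> limit_block j z -> i = j.
Proof.
apply: (@ointerval_inj _ [set zeta | olt zeta xi] oexp (fun z => oexp (osucc z))) => {}i {}j /= _ _.
have h a b : olt a b -> ole (oexp (osucc a)) (oexp b).
  move=> ab; apply: oexp_le; have [//|/olt_succ ba] := ole_total (osucc a) b.
  by case: (@olt_irr a); apply: olt_le_trans ba.
have [ij|/h] := ole_total i j; last by right; right.
have [ji|/h] := ole_total j i; last by right; left.
by left; apply: ole_anti.
Qed.

Definition below xi : set ord := [set z | olt z (oexp xi)].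

Section Regularity.
Variable xi : ord.
Hypotheses (reg : regular (below xi) (P1tree xi)) (ne : P1tree xi !=set0).

Let shifted n c := wmap (oadd (omul (oexp xi) n)) (wscale c (P1tree xi)).

Lemma regular_shifted n c : regular (block xi n.+1) (shifted n c).
Proof.
apply: (sub_regular _ (regular_wmap (@oadd_inj _) (regular_wscale c reg))).
move=> _ [z zxi <-]; split; first exact: ole_oaddr.
by rewrite omulS; apply: olt_oadd.
Qed.

Lemma shifted_neq0 n c : shifted n c !=set0.
Proof.
by have [[t w] h] := ne; exists (oshift (omul (oexp xi) n) t, c * w), t => //; exists w.
Qed.

Lemma block_below n : block xi n.+1 `&` [set z | olt z (omul (oexp xi) n)] `<=` set0.
Proof. by move=> z [[/= h _] h']; case: (@olt_irr z); apply: olt_le_trans h. Qed.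

(** Each new first segment is shifted by omega^xi times the number of segments behind it, hence lies
    above all their letters. *)
Lemma regular_Ptree_bound a :
  regular [set z | olt z (omul (oexp xi) (size a))] (Ptree xi a).
Proof.
elim: a => [|c a IH]; first by split=> [w []|t w []|t w w' []|s z w []].
apply: regular_wcomp (regular_shifted _ _) IH; first exact: block_below.
move=> z [[_ //]|/= h]; apply: olt_le_trans h _; exact: omul_le_nat.
Qed.

Lemma Ptree_head a t w : Ptree xi a (t, w) -> exists z u, t = z :: u /\ block xi (size a) z.
Proof.
case: a => [//|c a] [/(regular_cons (regular_shifted _ _))//|].
move=> [t1 [t2 [[w1 /(regular_cons (regular_shifted _ _))[z [u [-> Bz]]]] _ _ /= ->]]].
by exists z, (u ++ t2).
Qed.

(** The shift only renames letters and does not affect the game, so the segments are played one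
    after another. *)
Lemma value_Ptree (X : lmodType F) (N : set (set X)) c a (A : set X) :
  value N (Ptree xi (c :: a)) A =
  value N (wscale c (P1tree xi)) (value N (Ptree xi a) A).
Proof.
rewrite (@value_wcomp _ _ _ _ _ _ (fun z => `[< block xi (size a).+1 z >])).
- by rewrite value_wmap//; apply: oadd_inj.
- exact: shifted_neq0.
- by move=> t w /(regular_all (regular_shifted (size a) c)).
- move=> t w /(regular_all (regular_Ptree_bound a)); apply: sub_all => z /asboolP zb /=.
  by apply/asboolP => Bz; apply: (@block_below (size a) z).
- exact: regular_nil (regular_Ptree_bound a).
Qed.

Lemma Ptree_neq0 a : (0 < size a)%N -> Ptree xi a !=set0.
Proof.
by case: a => // c a _; have [tw h] := shifted_neq0 (size a) c; exists tw; left.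
Qed.

End Regularity.

Lemma P1tree0 : P1tree ozero = [set ([:: ozero], 1)].
Proof.
apply/seteqP; split=> [[t w] [p]|_ ->]; first by rewrite P1_graph0 => -[-> ->] /= ->; rewrite rmorph1.
by exists 1; rewrite ?P1_graph0 ?rmorph1.
Qed.

Lemma regular_limit_shift zeta c :
  regular (below (osucc zeta)) (P1tree (osucc zeta)) ->
  regular (limit_block zeta) (wmap (oadd (oexp zeta)) (wscale c (P1tree (osucc zeta)))).
Proof.
move=> reg.
apply: (sub_regular _ (regular_wmap (@oadd_inj _) (regular_wscale c reg))).
move=> _ [z zb <-]; split; first exact: ole_oaddr.
(* From z <= omega^zeta n follows omega^zeta + z <= omega^zeta (n+1) < omega^(zeta+1). *)
have [n zn] := olt_oexp_succ zb; apply: ole_lt_trans (olt_oexp n.+1 (olt_osucc zeta)).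
by apply: ole_trans (oadd_omul_le _ _); apply: oadd_le zn; apply: ole_refl.
Qed.

Lemma P1tree_regular xi : regular (below xi) (P1tree xi) /\ P1tree xi !=set0.
Proof.
elim/ord_ind: xi => [|xi [reg ne]|xi lim IH].
- rewrite P1tree0; split; last by exists ([:: ozero], 1).
  split=> [w [//]|t w [-> _] /=|t w w' [_ ->] [_ ->]//|].
    by rewrite /= andbT; apply/asboolP/olt_exp; left.
  by move=> s z w [e _]; left; case: s e => // y [].
- rewrite -(wscale1 (P1tree (osucc xi))) wscale_P1treeS; split.
    apply: (regular_bigcup (B := block xi)) => [i j z||i t w] /=.
    + exact: block_inj.
    + move=> n n0; apply: sub_regular (regular_Ptree_bound reg _).
      by move=> z /= /olt_trans; apply; apply/olt_oexp/olt_osucc.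
    + by move=> i0 /(Ptree_head reg); rewrite size_nseq.
  have [tw h] := @Ptree_neq0 xi ne (nseq 1 (1 / 1%:R)) isT.
  by exists tw, 1%N.
- rewrite -(wscale1 (P1tree xi)) wscale_P1tree_lim//.
  have rl zeta : olt zeta xi -> regular (limit_block zeta)
      (wmap (oadd (oexp zeta)) (wscale 1 (P1tree (osucc zeta)))).
    by move=> /(olimit_succ lim)/IH[reg _]; apply: regular_limit_shift.
  split.
    apply: (regular_bigcup (B := limit_block)) => [i j z||i t w] /=.
    + exact: limit_block_inj.
    + move=> zeta zx; apply: sub_regular (rl _ zx) => z [_ h].
      apply: olt_le_trans h _; apply: oexp_le; apply: oltW; exact: olimit_succ.
    + by move=> /rl/regular_cons; apply.
  (* The component of index zeta = 0 shows that the limit tree is non-empty. *)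
  have z0 := olimit_gt0 lim; have [_ [[t w] tw]] := IH _ (olimit_succ lim z0).
  exists (oshift (oexp ozero) t, 1 * w), ozero => //; exists t => //.
  by exists w.
Qed.

(** The first letter amounts to a free choice of n by the player; at a limit it is a choice of
    zeta. *)
Lemma value_P1treeS (X : lmodType F) (N : set (set X)) xi c (A : set X) :
  value N (wscale c (P1tree (osucc xi))) A =
  \bigcup_(n in [set n | (0 < n)%N]) value N (Ptree xi (nseq n (c / n%:R))) A.
Proof.
have [reg ne] := P1tree_regular xi.
rewrite wscale_P1treeS (@value_bigcup _ _ _ _ _ _ _ (block xi))//.
- by exists 1%N.
- by move=> n n0; apply: Ptree_neq0; rewrite // size_nseq.
- by move=> n t w n0 /(Ptree_head reg); rewrite size_nseq.
- exact: block_inj.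
Qed.

Lemma value_P1tree_lim (X : lmodType F) (N : set (set X)) xi c (A : set X) :
  olimit xi ->
  value N (wscale c (P1tree xi)) A =
  \bigcup_(zeta in [set zeta | olt zeta xi]) value N (wscale c (P1tree (osucc zeta))) A.
Proof.
move=> lim; rewrite wscale_P1tree_lim// (@value_bigcup _ _ _ _ _ _ _ limit_block).
- by apply: eq_bigcupr => zeta _; rewrite value_wmap//; apply: oadd_inj.
- by exists ozero; apply: olimit_gt0.
- move=> zeta _; have [_ [[t w] h]] := P1tree_regular (osucc zeta).
  by exists (oshift (oexp zeta) t, c * w), t => //; exists w.
- move=> zeta t w _; apply: regular_cons; apply: regular_limit_shift.
  exact: (P1tree_regular (osucc zeta)).1.
- by move=> i j z; apply: limit_block_inj.
Qed.

End Trees.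

(** * Forcing two targets at once *)

Section Intersection.
Variables (F : numFieldType) (X : lmodType F) (N : set (set X)).
Hypothesis NI : forall U U', N U -> N U' -> N (U `&` U').
Hypothesis Nconv : forall U x y (p q : F), N U -> U x -> U y ->
  0 <= p -> 0 <= q -> p + q = 1 -> U (p *: x + q *: y).

(** Seen as an operator on targets, so that playing n trees in succession is an n-fold iterate. *)
Let V xi c (A : set X) := value N (wscale c (@P1tree F xi)) A.

Lemma value_set0 (A : set X) : value N (set0 : wtree F ord) A = A.
Proof.
apply/seteqP; split=> v; last by move=> Av; apply: win_end => // t w [].
by move=> W; inversion W.
Qed.

Lemma value_nseq xi n c A : value N (Ptree xi (nseq n c)) A = iter n (V xi c) A.
Proof.
have [reg ne] := @P1tree_regular F xi.
by elim: n => [|n IH]; rewrite /= ?value_set0// value_Ptree// IH.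
Qed.

Lemma V0E c A : V ozero c A = [set v | exists2 U, N U & forall x, U x -> A (v + c *: x)].
Proof.
rewrite /V; have -> : wscale c (@P1tree F ozero) = [set ([:: ozero], c)].
  rewrite P1tree0; apply/seteqP; split=> [[t w] [_ /= [-> ->] ->]|_ ->]; first by rewrite mulr1.
  by exists 1; rewrite //= mulr1.
have tm : terminal [set ([:: ozero], c)] [:: ozero] by move=> t w [-> _].
apply/seteqP; split=> v.
  rewrite /value => W; inversion W as [s v' tG Av|s v' z w U Gw NU IH]; subst.
    by have := tG _ _ erefl (ex_intro _ [:: ozero] erefl).
  move: Gw IH => /= [-> ->] IH; exists U => // x /IH W'.
  inversion W' as [s' v2 _ Av|s' v2 z' w' U' e]; subst => //.
move=> [U NU UA]; apply: (@win_move _ _ _ _ _ _ [::] v ozero c U) => // x /UA.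
exact: win_end.
Qed.

Lemma VSE xi c A : V (osucc xi) c A =
  \bigcup_(n in [set n | (0 < n)%N]) iter n (V xi (c / n%:R)) A.
Proof. by rewrite /V value_P1treeS; apply: eq_bigcupr => n _; apply: value_nseq. Qed.

Lemma sub_V xi c A B : A `<=` B -> V xi c A `<=` V xi c B.
Proof. by move=> AB; apply: sub_win. Qed.

Lemma sub_iter_V xi c n A B : A `<=` B -> iter n (V xi c) A `<=` iter n (V xi c) B.
Proof. by move=> AB; elim: n => //= n IH; apply: sub_V. Qed.

Lemma sub_iter n (f g : set X -> set X) A : (forall B, f B `<=` g B) ->
  (forall B C, B `<=` C -> f B `<=` f C) -> iter n f A `<=` iter n g A.
Proof.
move=> fg fmono; elim: n => //= n IH.
exact: subset_trans (fmono _ _ IH) (fg _).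
Qed.

(** A move of weight [c] can be spread over [m] moves of weight [c / m], since
    the average of points of a set of [N] belongs to that set. *)
Lemma V_split xi m c A : (0 < m)%N -> V xi c A `<=` iter m (V xi (c / m%:R)) A.
Proof.
move=> m0; have m0F : (m%:R : F) != 0 by rewrite pnatr_eq0 -lt0n.
elim/ord_ind: xi c A => [|xi IH|xi lim IH] c A.
- rewrite -{1}(mulfVK m0F c); case: m m0 {m0F} => // m _.
  move: (c / _) => {}c; elim: m => [|m IH]; first by rewrite mulr1.
  rewrite {1}V0E => v [U NU UA]; rewrite iterS V0E; exists U => // x Ux; apply: IH.
  rewrite V0E; exists U => // y Uy.
  (* The answer [x] has weight c, and the remaining moves are merged into one answer [y] of weight c
     (m+1). Together they act as the mean r x + (m+1) r y, a point of the convex set [U], with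
     weight c (m+2). *)
  pose r : F := m.+2%:R^-1.
  have r0 : m.+2%:R != 0 :> F by rewrite pnatr_eq0.
  have := UA (r *: x + (m.+1%:R * r) *: y); rewrite -addrA => UA'.
  suff -> : c *: x + (c * m.+1%:R) *: y =
    (c * m.+2%:R) *: (r *: x + (m.+1%:R * r) *: y).
    apply: UA'; apply: Nconv => //; rewrite ?mulr_ge0 ?invr_ge0 ?ler0n//.
    by rewrite -[X in X + _]mul1r -mulrDl nat1r mulfV.
  rewrite scalerDr !scalerA -mulrA mulfV// mulr1; congr (_ + _ *: _).
  by rewrite -mulrA; congr (_ * _); rewrite mulrCA mulfV// mulr1.
- rewrite {1}VSE => v [n /= n0 /(sub_iter (IH _))].
  move=> /(_ (fun B C => @sub_V _ _ B C)).
  (* Each of the n trees has been split into m; the n m trees are regrouped as m runs of n. *)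
  have -> : iter n (iter m (V xi (c / n%:R / m%:R))) A =
            iter m (iter n (V xi (c / m%:R / n%:R))) A.
    by rewrite -!iterM mulnC mulrAC.
  apply: sub_iter => B; last by move=> C; apply: sub_iter_V.
  by rewrite VSE => u Bu; exists n.
- rewrite {1}/V value_P1tree_lim// => v [zeta /= zx /(IH _ (olimit_succ lim zx))].
  apply: sub_iter => B; last exact: sub_V.
  by move=> u Bu; rewrite /V value_P1tree_lim//; exists zeta.
Qed.

(** In a tree of higher order the player may choose n = 1 at successors and a suitable component at
    limits, so no power is lost. *)
Lemma V_le zeta xi c A : ole zeta xi -> V zeta c A `<=` V xi c A.
Proof.
elim/ord_ind: xi zeta => [|xi IH|xi lim IH] zeta zx.
- by rewrite (ole_anti zx (ole0 _)).
- have [zx'|xz] := ole_total zeta xi; last first.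
    have <- : zeta = osucc xi; last by [].
    apply: ole_anti => //; have [//|/olt_succ zx'] := ole_total (osucc xi) zeta.
    by case: (@olt_irr xi); apply: olt_le_trans zx'.
  by move=> v /(IH _ zx'); rewrite VSE => h; exists 1%N; rewrite //= divr1.
- have [zx'|xz] := ole_total xi zeta; first by rewrite (ole_anti zx zx').
  move=> v h; rewrite /V value_P1tree_lim//; exists zeta => //.
  by apply: IH h; [exact: olimit_succ|apply/oltW/olt_osucc].
Qed.

Lemma iter_setI n (f : set X -> set X) A B :
  (forall B C, B `<=` C -> f B `<=` f C) ->
  (forall B C, f B `&` f C `<=` f (B `&` C)) ->
  iter n f A `&` iter n f B `<=` iter n f (A `&` B).
Proof.
move=> fmono fI; elim: n => //= n IH.
exact: subset_trans (fI _ _) (fmono _ _ IH).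
Qed.

(** Two winning strategies are brought to the same tree, down to single moves, where their
    neighbourhoods are intersected. *)
Lemma V_setI xi c A B : V xi c A `&` V xi c B `<=` V xi c (A `&` B).
Proof.
elim/ord_ind: xi c A B => [|xi IH|xi lim IH] c A B.
- rewrite !V0E => v [[U NU UA] [U' NU' UB]].
  by exists (U `&` U'); [exact: NI|move=> x [/UA ? /UB]].
- rewrite !VSE => v [[n /= n0 An] [m /= m0 Bm]].
  (* The choices n and m have n m as common refinement, reached by [V_split] on either side. *)
  have nm0 : (0 < n * m)%N by rewrite muln_gt0 n0.
  exists (n * m)%N => //; apply: iter_setI; [exact: sub_V|exact: IH|split].
    rewrite natrM invfM mulrA iterM; move: An.
    by apply: sub_iter => [C|C D]; [apply: V_split|apply: sub_V].
  rewrite mulnC natrM invfM mulrA iterM; move: Bm.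
  by apply: sub_iter => [C|C D]; [apply: V_split|apply: sub_V].
- rewrite {1 2}/V !value_P1tree_lim// => v [[z zx zA] [z' zx' zB]].
  rewrite /V value_P1tree_lim//.
  (* Both strategies are moved to the larger of the two components. *)
  have [z'' [zx'' zz z'z]] : exists z'', [/\ olt z'' xi, ole z z'' & ole z' z''].
    have [zz'|/oltW zz'] := ole_total z z'; first by exists z'; split=> //; apply: ole_refl.
    by exists z; split=> //; apply: ole_refl.
  have succ_le a b : ole a b -> ole (osucc a) (osucc b).
    move=> ab; have [//|/olt_succ h] := ole_total (osucc a) (osucc b).
    by case: (@olt_irr b); apply: olt_le_trans (ole_trans h ab); apply: olt_osucc.
  exists z'' => //; apply: IH; first exact: olimit_succ.
  by split; [apply: (V_le (succ_le _ _ zz))|apply: (V_le (succ_le _ _ z'z))].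
Qed.

Lemma value_setI xi a (A B : set X) :
  value N (Ptree xi a) A `&` value N (Ptree xi a) B `<=` value N (Ptree xi a) (A `&` B).
Proof.
have [reg ne] := @P1tree_regular F xi.
elim: a => [|c a IH]; first by rewrite !value_set0.
rewrite !value_Ptree//; apply: subset_trans (@V_setI _ _ _ _) _.
exact: sub_V.
Qed.

End Intersection.

(** * Real and complex scalars, and finite nets of the unit disc *)

Local Open Scope complex_scope.

Section Scalars.
Variable R : realType.

(** Norms take values in the scalar field; embedding the reals allows them to be compared with real
    bounds. *)
Definition emb (k : scalars) : R -> scalar_field R k :=
  match k with Reals => id | Complexes => real_complex R end.
Arguments emb : clear implicits.

Lemma embD k (r s : R) : emb k (r + s) = emb k r + emb k s.
Proof. by case: k => //=; rewrite rmorphD. Qed.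

Lemma emb_ge0 k (r : R) : 0 <= r -> 0 <= emb k r.
Proof. by case: k => //=; rewrite ler0c. Qed.

Lemma emb_gt0 k (r : R) : 0 < r -> 0 < emb k r.
Proof. by case: k => //=; rewrite ltcR. Qed.

Lemma norm_complex (z : scalar_field R Complexes) :
  `|z| = (Num.sqrt (complex.Re z ^+ 2 + complex.Im z ^+ 2))%:C.
Proof. exact: normc_def. Qed.

Lemma re_le_norm k (z : scalar_field R k) : re z <= re `|z|.
Proof.
case: k z => z; first exact: ler_norm.
rewrite norm_complex /=; apply: le_trans (ler_norm _) _.
by rewrite -sqrtr_sqr ler_wsqrtr// lerDl sqr_ge0.
Qed.

Lemma le_emb k (z : scalar_field R k) (r : R) : (`|z| <= emb k r) = (re `|z| <= r).
Proof. by case: k z => // z; rewrite norm_complex lecE /= eqxx. Qed.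

Lemma emb_re_norm k (z : scalar_field R k) : emb k (re `|z|) = `|z|.
Proof. by case: k z => // z; rewrite norm_complex. Qed.

Lemma norm_real_ge0 k (z : scalar_field R k) : 0 <= re `|z|.
Proof. by case: k z => z; [exact: normr_ge0|rewrite norm_complex /= sqrtr_ge0]. Qed.

Definition grid (N : nat) : seq R :=
  [seq n%:R / N%:R | n <- iota 0 N.+1] ++ [seq - (n%:R / N%:R) | n <- iota 0 N.+1].

(** Round [c] towards zero to a multiple of [1 / N]. *)
Lemma grid_approx N (c : R) : (0 < N)%N -> `|c| <= 1 ->
  exists2 r, r \in grid N & `|r| <= `|c| /\ c ^+ 2 - N%:R^-1 <= r * c.
Proof.
move=> N0 c1; have N0R : 0 < N%:R :> R by rewrite ltr0n.
pose n := Num.truncn (`|c| * N%:R).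
have /andP[nc cn] : n%:R <= `|c| * N%:R < n.+1%:R.
  by apply: truncn_itv; rewrite mulr_ge0.
have nN : (n < N.+1)%N.
  by rewrite ltnS -(ler_nat R) (le_trans nc)// ger_pMl.
have rc : n%:R / N%:R <= `|c| by rewrite ler_pdivrMr.
have cr : `|c| - N%:R^-1 <= n%:R / N%:R.
  rewrite lerBlDr -[X in _ / _ + X]mul1r -mulrDl ler_pdivlMr//.
  by rewrite -natr1 in cn; apply: ltW.
have key : c ^+ 2 - N%:R^-1 <= (n%:R / N%:R) * `|c|.
  rewrite -real_normK ?num_real// expr2.
  have := ler_wpM2r (normr_ge0 c) cr; apply: le_trans.
  rewrite mulrBl lerD2l lerN2 -[leRHS]mulr1 ler_wpM2l// invr_ge0 ltW//.
have r0 : 0 <= n%:R / N%:R :> R by rewrite divr_ge0.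
have [c0|c0] := leP 0 c.
  exists (n%:R / N%:R); last first.
    by split; [rewrite (ger0_norm r0)|move: key; rewrite (ger0_norm c0)].
  by rewrite mem_cat; apply/orP; left; apply: (map_f (fun n => n%:R / N%:R)); rewrite mem_iota.
exists (- (n%:R / N%:R)); last first.
  by split; [rewrite normrN (ger0_norm r0)|move: key; rewrite (ltr0_norm c0) mulrN mulNr].
rewrite mem_cat; apply/orP; right.
by apply: (map_f (fun n => - (n%:R / N%:R))); rewrite mem_iota.
Qed.

(** Over the reals two signs suffice. In the complex case conj z / |z| is rounded to a grid point;
    rounding towards zero stays in the unit disc and loses at most 1/N per coordinate. *)
Lemma rotation_net k (rho : R) : rho < 1 ->
  exists2 L : seq (scalar_field R k), (forall e, e \in L -> `|e| <= 1) &
    forall z, exists2 e, e \in L & rho * re `|z| <= re (e * z).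
Proof.
move=> rho1; case: k.
  exists [:: 1; -1] => [e|z].
    by rewrite !inE => /orP[]/eqP->; rewrite ?normrN normr1.
  have zz : rho * `|z| <= `|z| by rewrite -[leRHS]mul1r ler_wpM2r// ltW.
  have [z0|z0] := leP 0 z; [exists 1|exists (-1)]; rewrite ?inE ?eqxx ?orbT//.
    by rewrite mul1r /=; rewrite -{2}(ger0_norm z0).
  by rewrite mulN1r /= -(ltr0_norm z0).
(* The total relative loss 2/N has to be at most 1 - rho. *)
pose N := (Num.truncn (2 / (1 - rho))).+1.
have d0 : 0 < 1 - rho by rewrite subr_gt0.
have NN : 2 / N%:R <= 1 - rho.
  rewrite ler_pdivrMr ?ltr0n// mulrC -ler_pdivrMr//; apply: ltW.
  by have /andP[] := truncn_itv (divr_ge0 (ler0n R 2) (ltW d0)).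
exists [seq e <- [seq (r +i* s)%C | r <- grid N, s <- grid N] | `|e| <= 1] => [e|z].
  by rewrite mem_filter => /andP[].
have [->|z0] := eqVneq z 0.
  exists 0; last by rewrite normr0 /= mulr0 mulr0.
  have [r rG [r0 _]] := @grid_approx N 0 isT (eq_ind_r (fun x => x <= 1) ler01 (normr0 R)).
  move: r0; rewrite normr0 normr_le0 => /eqP r0; rewrite {}r0 in rG.
  rewrite mem_filter normr0 ler01 /=.
  exact: (allpairs_f (fun r s => r +i* s) rG rG).
case: z z0 => x y z0.
pose m := Num.sqrt (x ^+ 2 + y ^+ 2).
have m2 : m ^+ 2 = x ^+ 2 + y ^+ 2 by rewrite sqr_sqrtr// addr_ge0 ?sqr_ge0.
have m0 : 0 < m.
  rewrite lt_neqAle sqrtr_ge0 andbT eq_sym; apply: contra z0 => /eqP m0.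
  move: m2; rewrite m0 expr0n /= => /esym/eqP; rewrite paddr_eq0 ?sqr_ge0// !sqrf_eq0.
  by move=> /andP[/eqP-> /eqP->].
have xm : (x / m) ^+ 2 + (y / m) ^+ 2 = 1.
  by rewrite !expr_div_n -mulrDl -m2 divff// expf_neq0// gt_eqF.
have le1 (a b : R) : a ^+ 2 + b ^+ 2 = 1 -> `|a| <= 1.
  move=> ab; rewrite -(@ler_pXn2r _ 2)// ?nnegrE// real_normK ?num_real//.
  by rewrite expr1n -ab lerDl sqr_ge0.
(* With r near x/m and s near -y/m, the real part of (r + i s) z is r x - s y, close to m. *)
have [r rG [rx rb]] := grid_approx (isT : 0 < N)%N (le1 _ _ xm).
have ym : (- (y / m)) ^+ 2 + (x / m) ^+ 2 = 1 by rewrite sqrrN addrC.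
have [s sG [sy sb]] := grid_approx (isT : 0 < N)%N (le1 _ _ ym).
have sqle (a b : R) : `|a| <= `|b| -> a ^+ 2 <= b ^+ 2.
  by move=> ab; rewrite -(real_normK (num_real a)) -(real_normK (num_real b)) ler_sqr ?nnegrE.
exists (r +i* s)%C.
  rewrite mem_filter; apply/andP; split; last by apply: allpairs_f.
  rewrite norm_complex lecE /= eqxx /= -[leRHS]sqrtr1 ler_wsqrtr// -ym addrC.
  by apply: lerD; apply: sqle.
rewrite norm_complex /= -/m.
have -> : r * x - s * y = m * (r * (x / m) + s * - (y / m)).
  by field; rewrite gt_eqF.
rewrite mulrC ler_pM2l//; apply: le_trans (lerD rb sb).
rewrite addrACA sqrrN xm -opprD -mulr2n -[_ *+ 2]mulr_natl.
by rewrite lerBrDr -lerBrDl.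
Qed.
End Scalars.

Local Close Scope complex_scope.

(** * Bounds at a point of X for functionals in the weak-star closed absolutely convex hull *)

Section Hull.
Variables (R : realType) (k : scalars).
Local Notation F := (scalar_field R k).
Variable X : normedModType F.
Implicit Types (K : set {ptws X -> F}) (y : X).

Lemma re_norm_triangle (a b : F) : re `|a| <= re `|b| + re `|b - a|.
Proof.
rewrite -le_emb embD !emb_re_norm; apply: le_trans (ler_normB _ _).
by rewrite subKr.
Qed.

Lemma nbhs_ptws_ball (g : {ptws X -> F}) y (e : R) : 0 < e ->
  \forall h \near g, re `|g y - h y| <= e.
Proof.
move=> e0.
have U : nbhs (g y) (ball (g y) (emb k e)) by apply: nbhsx_ballx; apply: emb_gt0.
have near_g := @proj_continuous X (fun=> F) y g _ U.
have near_g' : \forall h \near g, `|g y - h y| < emb k e by exact: near_g.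
have sub : [set h : {ptws X -> F} | `|g y - h y| < emb k e] `<=`
    [set h | re `|g y - h y| <= e] by move=> h /= ge; rewrite -le_emb; exact: ltW.
exact: (@filterS _ (nbhs g) (nbhs_filter g) _ _ sub near_g').
Qed.

(** The modulus of the evaluation at [y] is continuous, so its image of [K] is compact. This makes
    the supremum in [rfun] one of a bounded set. *)
Lemma compact_ptws_bounded K y : compact K ->
  exists M, forall f, K f -> re `|f y| <= M.
Proof.
move=> cK; pose phi (g : {ptws X -> F}) : R^o := re `|g y|.
have cphi : continuous phi.
  move=> g U /nbhs_ballP[e /= e0 eU].
  have e20 : 0 < e / 2 by rewrite divr_gt0.
  apply: (@filterS _ (nbhs g) (nbhs_filter g) _ _ _ (nbhs_ptws_ball g y e20)).
  move=> h /= he; apply: eU; rewrite /ball /= /phi.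
  have lt_e : e / 2 < e by rewrite ltr_pdivrMr// ltr_pMr// ltr1n.
  apply: le_lt_trans lt_e; rewrite ler_norml; apply/andP; split.
    rewrite lerBrDl lerBlDr; apply: le_trans (re_norm_triangle _ (g y)) _.
    by rewrite lerD2l.
  rewrite lerBlDl; apply: le_trans (re_norm_triangle _ (h y)) _.
  by rewrite lerD2l distrC.
have /compact_bounded[M [_ hM]] := continuous_compact (continuous_subspaceT cphi) cK.
exists (M + 1) => f Kf; apply: le_trans (ler_norm _) _.
by apply: (hM (M + 1)); [rewrite ltrDl|exists f].
Qed.

(** The set of g with |g(y)| <= M is absolutely convex and closed under pointwise limits. *)
Lemma wstar_abs_co_norm_le K y (M : R) : 0 <= M ->
  (forall f, K f -> re `|f y| <= M) -> forall g, wstar_abs_co K g -> re `|g y| <= M.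
Proof.
move=> M0 KM g [+ _]; pose A := [set g : {ptws X -> F} | re `|g y| <= M].
have KA : smallest (@abs_convex R k X) K `<=` A.
  apply: smallest_sub => // f h a b; rewrite /A /= -!le_emb => fM hM ab1.
  apply: le_trans (ler_normD _ _) _; rewrite !normrM.
  apply: (@le_trans _ _ ((`|a| + `|b|) * emb k M)).
    by rewrite mulrDl lerD// ler_wpM2l.
  by rewrite -[leRHS]mul1r ler_wpM2r// emb_ge0.
move=> gK; apply/ler_addgt0Pr => e e0.
have [h [/KA hM hg]] := gK _ (nbhs_ptws_ball g y e0).
apply: le_trans (re_norm_triangle _ (h y)) _; apply: lerD => //.
by rewrite distrC.
Qed.

Lemma sub_wstar_abs_co K : K `<=` @dual_space R k X -> K `<=` wstar_abs_co K.
Proof.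
move=> Kd f Kf; split; last exact: Kd.
by apply: subset_closure; apply: sub_smallest Kf.
Qed.

(** The empty set satisfies [abs_convex], which only speaks of combinations of given members. *)
Lemma wstar_abs_co0 : wstar_abs_co (set0 : set {ptws X -> F}) = set0.
Proof.
apply/seteqP; split=> // g [+ _].
have -> : smallest (@abs_convex R k X) set0 = set0.
  by apply/seteqP; split=> //; apply: smallest_sub => // f h a b [].
by rewrite closure0.
Qed.

Lemma rfun_le K y (M : R) : K !=set0 -> (forall f, K f -> re (f y) <= M) -> rfun K y <= M.
Proof.
move=> K0 KM; rewrite /rfun; case: eqP K0 => [-> []//|_ [f Kf]].
apply: ge_sup; first by exists (re (f y)), f.
by move=> _ [g /KM gM <-].
Qed.

Lemma rfun_ge K y (M : R) f : (forall f, K f -> re (f y) <= M) -> K f ->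
  re (f y) <= rfun K y.
Proof.
move=> KM Kf; rewrite /rfun; case: eqP => [K0|_]; first by move: Kf; rewrite K0.
apply: ub_le_sup; last by exists f.
by exists M => _ [g /KM gM <-].
Qed.

End Hull.

(** * From the game trees to Gamma_{xi,n}.D and the vectors z_i^t *)

Section Link.
Variables (F : numFieldType) (xi : ord) (n : nat).
Implicit Types (a : 'I_n -> F) (t : seq ord).

Lemma Ptree_lambdaP a t w : Ptree xi (mktuple a) (t, w) <->
  exists (i : 'I_n) p, lambda_graph (P1_graph xi) xi n i.+1 (t, p) /\ w = a i * ratr p.
Proof.
split=> [/PtreeE[i [p []]]|[i [p [tp ->]]]].
  rewrite size_tuple => /andP[i0 ni] tp ->; case: i i0 ni tp => // i _ ni tp.
  by exists (Ordinal ni), p; rewrite -(nth_mktuple a 0).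
by apply/PtreeE; exists i.+1, p; rewrite size_tuple ltn_ord -(nth_mktuple a 0).
Qed.

Lemma gamma_graphP t p : gamma_graph (P1_graph xi) xi n (t, p) <->
  exists i : 'I_n, lambda_graph (P1_graph xi) xi n i.+1 (t, p).
Proof.
split=> [[i /andP[i0 ni]]|[i tp]]; last by exists i.+1 => //=; rewrite ltn_ord.
by case: i i0 ni => // i _ ni tp; exists (Ordinal ni).
Qed.

Lemma Ptree_Gamma a t : (exists w, Ptree xi (mktuple a) (t, w)) <-> Gamma xi n t.
Proof.
split=> [[w /Ptree_lambdaP[i [p [tp _]]]]|[[s p] /gamma_graphP[i tp] /= st]].
  by exists (t, p) => //; apply/gamma_graphP; exists i.
by rewrite -st; exists (a i * ratr p); apply/Ptree_lambdaP; exists i, p.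
Qed.

Lemma Ptree_fun a : wfunctional (Ptree xi (mktuple a)).
Proof.
exact: regular_fun (regular_Ptree_bound (@P1tree_regular F xi).1 _).
Qed.

Lemma ratr_inj : injective (ratr : rat -> F).
Proof. exact: fmorph_inj. Qed.

(** With all coefficients 1, single-valuedness of the tree weights shows that P_{xi,n} is a
    function. *)
Lemma Pval_lambda (i : 'I_n) t p :
  lambda_graph (P1_graph xi) xi n i.+1 (t, p) -> Pval xi n t = p.
Proof.
move=> tp; rewrite /Pval; case: xgetP => [q _|]; last first.
  by move=> /(_ p); case; apply/gamma_graphP; exists i.
move=> /gamma_graphP[j tq]; apply: ratr_inj; rewrite -[LHS]mul1r -[RHS]mul1r.
apply: (@Ptree_fun (fun=> 1) t); apply/Ptree_lambdaP; first by exists j, q.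
by exists i, p.
Qed.

(** A sum over all i, so that exchanging summations turns the sum of the a_i z_i^t into a branch
    sum. *)
Definition Pweight a t : F :=
  \sum_(i < n | `[< Lambda xi n i.+1 t >]) a i * ratr (Pval xi n t).

(** If [t] belonged to two of the sets Lambda_{xi,n,i}, then its weight would
    vanish for every choice of the coefficients. *)
Lemma Ptree_weight a t w : Ptree xi (mktuple a) (t, w) -> Pweight a t = w.
Proof.
move=> /Ptree_lambdaP[i [p [tp ->]]].
have ti : `[< Lambda xi n i.+1 t >] by apply/asboolP; exists (t, p).
rewrite /Pweight (Pval_lambda tp) (bigD1 i)//= big1 ?addr0// => j /andP[/asboolP[]].
move=> [s q] /= tq st ji; rewrite {}st in tq.
have pq : q = p by rewrite -(Pval_lambda tp) (Pval_lambda tq).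
have := @Ptree_fun (fun l => (l == i)%:R) t (1 * ratr p) (0 * ratr q).
rewrite mul1r mul0r => -> //; first by rewrite mulr0.
  by apply/Ptree_lambdaP; exists i, p; rewrite eqxx mul1r.
by apply/Ptree_lambdaP; exists j, q; rewrite (negbTE ji) mul0r.
Qed.

End Link.

Section Trees.
Variables (R : realType) (k : scalars).
Local Notation F := (scalar_field R k).
Variables (X : normedModType F) (xi : ord) (n : nat) (a : 'I_n -> F).
Hypothesis n_gt0 : (0 < n)%N.
Let G := Ptree xi (mktuple a).

Lemma zvec_bsum D (x : seq (ord * D) -> X) t :
  \sum_(i < n) a i *: zvec xi n i.+1 x t = bsum (Pweight xi a) x t.
Proof.
under eq_bigr do rewrite /zvec big_mkcond scaler_sumr.
rewrite exchange_big /=; apply: eq_bigr => m _.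
rewrite /Pweight scaler_suml [RHS]big_mkcond; apply: eq_bigr => i _.
by rewrite /LambdaD /=; case: asboolP => _; rewrite ?scaler0// scalerA.
Qed.

(** The components in [D] are free: any extension of the ordinal part lifts by filling in [u0]. *)
Lemma MAX_GammaD D (u0 : D) (t : seq (ord * D)) :
  MAX (GammaD xi n) t <-> (exists w, G (unzip1 t, w)) /\ terminal G (unzip1 t).
Proof.
split=> [[Gt tmax]|[Gt tT]].
  split; first exact/Ptree_Gamma.
  move=> s w Gs [u sE].
  suff <- : t ++ map (fun z => (z, u0)) u = t by rewrite /unzip1 map_cat -map_comp map_id.
  apply: tmax; last by exists (map (fun z => (z, u0)) u).
  have sG : Gamma xi n s by apply/(iffLR (Ptree_Gamma xi a s)); exists w.
  by rewrite /GammaD /mkset /unzip1 map_cat -map_comp map_id -sE.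
split; first exact: (iffLR (Ptree_Gamma xi a _)).
move=> s /(iffRL (Ptree_Gamma xi a _))[w Gs] [u sE].
have := tT _ _ Gs (ex_intro _ (unzip1 u) _).
rewrite sE /unzip1 map_cat => /(_ erefl)/(congr1 size); rewrite size_cat size_map.
by move=> /eqP; rewrite -[X in _ == X]addn0 eqn_add2l size_map => /nilP ->; rewrite cats0.
Qed.

Lemma tree_branch D (le : D -> D -> Prop) (x : seq (ord * D) -> X) (A : set X) :
  directed le -> (forall t, GammaD xi n t -> `|x t| <= 1) ->
  weakly_null_tree le xi n x -> value (range (@wnbhs R k X)) G A 0 ->
  exists2 t, MAX (GammaD xi n) t & A (\sum_(i < n) a i *: zvec xi n i.+1 x t).
Proof.
move=> dir x1 wx W.
have wE : forall t w, G (t, w) -> Pweight xi a t = w by move=> t w; apply: Ptree_weight.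
have x1' (t : seq (ord * D)) : (exists w, G (unzip1 t, w)) -> `|x t| <= 1.
  by move=> /Ptree_Gamma/x1.
have wx' (s : seq (ord * D)) z : s = [::] \/ (exists w, G (unzip1 s, w)) ->
    (exists w, G (rcons (unzip1 s) z, w)) -> weakly_null le (fun u => x (rcons s (z, u))).
  move=> sG /Ptree_Gamma szG; apply: wx => [|u].
    by case: sG => [|/Ptree_Gamma]; [left|right].
  by rewrite /GammaD /mkset /unzip1 map_rcons.
have [t [t0 tT At]] := win_branch wE dir x1' wx' W.
have [[u0] _ _ _] := dir.
exists t; last by rewrite zvec_bsum.
apply/(MAX_GammaD u0); split=> //; case: t0 => // t0; move: tT; rewrite t0 => tT.
(* As n > 0 the tree has a node, so an empty branch could be terminal only by being a node
   itself. *)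
have [[s w] Gs] : G !=set0.
  have [reg ne] := @P1tree_regular F xi.
  by apply: Ptree_neq0 => //; rewrite size_tuple.
by exists w; rewrite -(tT _ _ Gs) //; exists s.
Qed.

(** When the player cannot force [A], the replies of the opponent form the required tree over finite
    lists of functionals. *)
Lemma tree_strategy (A : set X) : ~ value (range (@wnbhs R k X)) G A 0 ->
  exists (D : Type) (le : D -> D -> Prop) (x : seq (ord * D) -> X),
    [/\ directed le, forall t, GammaD xi n t -> `|x t| <= 1, weakly_null_tree le xi n x &
     forall t, MAX (GammaD xi n) t -> ~ A (\sum_(i < n) a i *: zvec xi n i.+1 x t)].
Proof.
move=> nW; have [reg _] := @P1tree_regular F xi.
exists (seq {ptws X -> F}), (@incl_le R k X), (reply_tree G (Pweight xi a) A).
split=> [|t _|s z _ _|t].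
- exact: directed_incl.
- exact: reply_tree_le1.
- exact: reply_tree_weakly_null.
rewrite (MAX_GammaD [::]) zvec_bsum => -[Gt tT].
have wE : forall t w, G (t, w) -> Pweight xi a t = w by move=> t' w; apply: Ptree_weight.
apply: (reply_tree_loses wE _ nW) => // s z [w Gsz].
exact: (regular_prefix (regular_Ptree_bound reg _) Gsz).
Qed.

End Trees.

(** * Comparison of the bounds for K and for its hull *)

Section Comparison.
Variables (R : realType) (k : scalars).
Local Notation F := (scalar_field R k).
Variable X : normedModType F.

Lemma dual_spaceZ (f : {ptws X -> F}) (c : F) (y : X) : dual_space f -> f (c *: y) = c * f y.
Proof.
move=> [flin _]; have f0 := flin (-1) 0 0; have := flin c y 0.
by move: f0; rewrite scaler0 !addr0 mulN1r addNr => ->; rewrite addr0.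
Qed.

Lemma wnbhs_convex S (x y : X) (p q : F) : wnbhs S x -> wnbhs S y ->
  0 <= p -> 0 <= q -> p + q = 1 -> wnbhs S (p *: x + q *: y).
Proof.
move=> [x1 fx] [y1 fy] p0 q0 pq; split=> [|f fS df].
  rewrite -pq; apply: le_trans (ler_normD _ _) _; rewrite !normrZ !ger0_norm//.
  by apply: lerD; rewrite -[leRHS]mulr1 ler_wpM2l.
have [flin _] := df; rewrite flin (dual_spaceZ _ _ df) -pq.
apply: le_lt_trans (ler_normD _ _) _; rewrite !normrM (ger0_norm p0) (ger0_norm q0).
have {}fx := fx f fS df; have {}fy := fy f fS df.
(* Strictness has to come from a non-zero coefficient. *)
have [qE|q_neq0] := eqVneq q 0.
  by move: pq; rewrite qE mul0r !addr0 => ->; rewrite mul1r.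
apply: ler_ltD; first by rewrite -[leRHS]mulr1 ler_wpM2l// ltW.
by rewrite -[ltRHS]mulr1 ltr_pM2l// lt_neqAle eq_sym q_neq0.
Qed.

Lemma zvecZ D xi n i (e : F) (x : seq (ord * D) -> X) t :
  zvec xi n i (fun s => e *: x s) t = e *: zvec xi n i x t.
Proof.
by rewrite /zvec scaler_sumr; apply: eq_bigr => m _; rewrite !scalerA mulrC.
Qed.

Lemma lp_norm_ge0 (p : \bar R) n (a : 'I_n -> F) : 0 <= lp_norm p a.
Proof.
rewrite /lp_norm; case: p => [r||]; first exact: powR_ge0.
  by elim/big_ind: _ => // [x y x0 y0|i _]; [rewrite le_max x0|apply: norm_real_ge0].
by elim/big_ind: _ => // [x y x0 y0|i _]; [rewrite le_max x0|apply: norm_real_ge0].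
Qed.

Variables (xi : ord) (p : \bar R) (n : nat) (K : set {ptws X -> F}).
Hypotheses (n_gt0 : (0 < n)%N) (K_dual : K `<=` @dual_space R k X)
  (K_compact : compact K) (K_neq0 : K !=set0).

Definition alpha_bound (K' : set {ptws X -> F}) (alpha : R) : Prop :=
  forall (D : Type) (le : D -> D -> Prop), directed le ->
  forall (a : 'I_n -> F) (x : seq (ord * D) -> X),
    (forall t, GammaD xi n t -> `|x t| <= 1) ->
    weakly_null_tree le xi n x ->
    (ereal_inf [set (rfun K' (\sum_(i < n) a i *: zvec xi n i.+1 x t))%:E
               | t in MAX (GammaD xi n)]
     <= (alpha * lp_norm p a)%:E)%E.

Lemma rfun_le_wstar_abs_co y : rfun K y <= rfun (wstar_abs_co K) y.
Proof.
have [M KM] := compact_ptws_bounded y K_compact.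
have [f0 Kf0] := K_neq0.
have M0 : 0 <= M := le_trans (norm_real_ge0 _) (KM _ Kf0).
apply: rfun_le => // f Kf; apply: (@rfun_ge _ _ _ _ _ M).
  by move=> g /(wstar_abs_co_norm_le M0 KM)/(le_trans (re_le_norm _)).
exact: sub_wstar_abs_co.
Qed.

Lemma alpha_bound_wstar_abs_co alpha :
  alpha_bound (wstar_abs_co K) alpha -> alpha_bound K alpha.
Proof.
move=> h D le dir a x x1 wx; apply: le_trans (h D le dir a x x1 wx).
apply: le_ereal_inf_tmp => _ [t tmax <-].
apply: (@le_trans _ _ (rfun K (\sum_(i < n) a i *: zvec xi n i.+1 x t))%:E).
  by apply: ereal_inf_lbound; exists t.
by rewrite lee_fin rfun_le_wstar_abs_co.
Qed.

Let target (beta : R) (e : F) : set X := [set y | forall f, K f -> re (e * f y) <= beta].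

(** Otherwise the opponent has a weakly null tree all of whose final sums miss the target.
    Multiplied by e it stays in the ball, and its values of [rfun] are all at least beta, against
    the bound alpha |a| < beta. *)
Lemma value_target alpha (a : 'I_n -> F) beta e : alpha_bound K alpha -> `|e| <= 1 ->
  alpha * lp_norm p a < beta ->
  value (range (@wnbhs R k X)) (Ptree xi (mktuple a)) (target beta e) 0.
Proof.
move=> h e1 ab; apply: contrapT => /tree_strategy[D [le [x [dir x1 wx xmax]]]].
have := h D le dir a (fun t => e *: x t).
have ex1 t : GammaD xi n t -> `|e *: x t| <= 1.
  by move=> /x1 xt; rewrite normrZ mulr_ile1.
have ewx : weakly_null_tree le xi n (fun t => e *: x t).
  move=> s z sG szG f df; have /(_ f df) := wx s z sG szG.
  move=> /(@cvgMl_tmp _ _ _ _ _ e); rewrite mulr0.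
  suff -> : (fun u => f (e *: x (rcons s (z, u)))) =
      (fun u => e * f (x (rcons s (z, u)))) by apply; apply: filter_tails.
  by apply/funext => u; apply: dual_spaceZ.
move=> /(_ ex1 ewx); apply/negP; rewrite -ltNge.
apply: (@lt_le_trans _ _ beta%:E); first by rewrite lte_fin.
apply: le_ereal_inf_tmp => _ [t /xmax nt <-]; rewrite lee_fin.
have [f nf] := iffRL (existsNP _) nt.
have [Kf /negP] := iffLR (not_implyP _ _) nf; rewrite -ltNge => bf.
have [M KM] := compact_ptws_bounded (\sum_(i < n) a i *: zvec xi n i.+1 (fun t => e *: x t) t) K_compact.
apply: le_trans (rfun_ge _ Kf); last by move=> g /KM/(le_trans (re_le_norm _)); apply.
under eq_bigr do rewrite zvecZ scalerA mulrC -scalerA.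
by rewrite -scaler_sumr (dual_spaceZ _ _ (K_dual Kf)) ltW.
Qed.

Lemma alpha_bound_hull alpha : 0 < alpha ->
  alpha_bound K alpha -> alpha_bound (wstar_abs_co K) alpha.
Proof.
move=> alpha0 h D le dir a x x1 wx; apply/lee_addgt0Pr => eps eps0.
set m := alpha * lp_norm p a.
have m0 : 0 <= m by rewrite mulr_ge0 ?lp_norm_ge0// ltW.
(* The gap between m and beta makes [value_target] applicable; the gap between beta and gamma makes
   the ratio beta / gamma less than 1, as the net requires. *)
pose beta := m + eps / 2; pose gamma := m + eps.
have e2 : 0 < eps / 2 by rewrite divr_gt0.
have gamma0 : 0 < gamma by rewrite ltr_wpDl.
have bg : beta < gamma.
  by rewrite ltrD2l ltr_pdivrMr// ltr_pMr// ltr1n.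
have rho1 : beta / gamma < 1 by rewrite ltr_pdivrMr// mul1r.
have beta0 : 0 < beta by rewrite ltr_wpDl.
have [L L1 Lnet] := rotation_net k rho1.
have Lwin e : e \in L ->
    value (range (@wnbhs R k X)) (Ptree xi (mktuple a)) (target beta e) 0.
  by move=> eL; apply: (value_target h (L1 _ eL)); rewrite ltrDl.
have NI U U' : range (@wnbhs R k X) U -> range (@wnbhs R k X) U' ->
    range (@wnbhs R k X) (U `&` U').
  by move=> [S _ <-] [S' _ <-]; rewrite -wnbhs_cat; exists (S ++ S').
have Nconv U y z (q r : F) : range (@wnbhs R k X) U -> U y -> U z ->
    0 <= q -> 0 <= r -> q + r = 1 -> U (q *: y + r *: z).
  by move=> [S _ <-]; apply: wnbhs_convex.
(* One member of [L] serves as seed, so that the induction over the list starts from a target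
   already forced. *)
have [e0 e0L _] := Lnet 0.
have W : value (range (@wnbhs R k X)) (Ptree xi (mktuple a))
    (target beta e0 `&` [set y | forall e, e \in L -> target beta e y]) 0.
  have := Lwin _ e0L; elim: {e0L Lnet L1}L Lwin => [|e L IH] Lwin We0.
    by apply: sub_win We0 => y ye0; split.
  have WL := IH (fun e' e'L => Lwin e' (mem_behead (s := e :: L) e'L)) We0.
  apply: sub_win (value_setI NI Nconv (conj (Lwin e (mem_head _ _)) WL)).
  move=> y [ye [ye0 yL]]; split=> // e'.
  by rewrite inE => /orP[/eqP->|/yL].
have [t tmax [_ ty]] := tree_branch n_gt0 dir x1 wx W.
set y := \sum_(i < n) _ in ty.
(* For a suitable e in the net, (beta / gamma) |f(y)| <= Re(e f(y)) <= beta. *)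
have Ky f : K f -> re `|f y| <= gamma.
  move=> Kf; have [e eL ef] := Lnet (f y).
  have := le_trans ef (ty e eL f Kf).
  by rewrite mulrAC ler_pdivrMr// ler_pM2l.
apply: ge_ereal_inf; exists (rfun (wstar_abs_co K) y)%:E; first by exists t.
rewrite -EFinD lee_fin; apply: rfun_le.
  by have [f Kf] := K_neq0; exists f; apply: sub_wstar_abs_co.
by move=> g /(wstar_abs_co_norm_le (ltW gamma0) Ky)/(le_trans (re_le_norm _)).
Qed.

Lemma alpha_n_wstar_abs_co : alpha_n xi p n K = alpha_n xi p n (wstar_abs_co K).
Proof.
rewrite /alpha_n; congr (ereal_inf (_ @` _)); apply/seteqP; split=> alpha [alpha0 h].
  by split=> //; apply: alpha_bound_hull.
by split=> //; apply: alpha_bound_wstar_abs_co.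
Qed.

End Comparison.
Theorem theorem1p2 (R : realType) (k : scalars)
    (X : completeNormedModType (scalar_field R k))
    (K : set {ptws X -> scalar_field R k})
    (K_dual : K `<=` @dual_space R k X) (K_compact : compact K)
    (xi : ord) (p : \bar R) (p_gt1 : (1 < p)%E) :
  alpha xi p K = alpha xi p (wstar_abs_co K).
Proof.
(* The empty set is its own hull; it is treated apart because [rfun] is 0 there by convention. *)
have [->|/set0P K_neq0] := eqVneq K set0; first by rewrite wstar_abs_co0.
rewrite /alpha; congr ereal_sup; apply: eq_imagel => n /= n_gt0.
exact: alpha_n_wstar_abs_co.
Qed.
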